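(* Let $m\ge2$, $n\ge1$, and let $\gamma\colon[0,\alpha]\to\mathbb{R}^{m+n}$ be a smooth unit-speed embedded curve whose curvature never vanishes. Let $\mathscr{D}_0$ be an $m$-dimensional subspace of $T_{\gamma(0)}\mathbb{R}^{m+n}$ such that $\dot\gamma(0)\in\mathscr{D}_0$ and $\ddot\gamma(0)\in\mathscr{D}_0^{\perp}$. Assume that $\gamma$ is full. Then there exists a full $m$-dimensional rank-one submanifold $M$ of $\mathbb{R}^{m+n}$ containing $\gamma$, with $T_{\gamma(0)}M=\mathscr{D}_0$, and containing $\gamma$ as a geodesic.
   Context: $\mathscr{D}_0^{\perp}$ is the Euclidean orthogonal complement of $\mathscr{D}_0$. A curve or submanifold of $\mathbb{R}^{m+n}$ is full if it is not contained in any totally geodesic submanifold (affine subspace) of dimension less than $m+n$. An $m$-dimensional embedded submanifold $M$ of $\mathbb{R}^{m+n}$ with second fundamental form $\alpha^M$ is rank-one if at every $p\in M$ the nullity space $\{x\in T_pM\mid\alpha^M(x,\cdot)=0\}$ has dimension $m-1$; equivalently, $M$ has no point where $\alpha^M$ vanishes, is foliated by open subsets of $(m-1)$-dimensional affine subspaces, and its tangent space is constant along each of them. ''Containing $\gamma$ as a geodesic'' means that $\gamma$ is a geodesic of $M$ with the induced metric. *)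

(* Defs.v *)
(* The ambient space R^N is 'rV[R]_N; its library norm is
   the sup norm, which is used for topology and differentiability only.  The
   Euclidean metric is [dot]. *)
From HB Require Import structures.
From mathcomp Require Import all_boot all_order all_algebra.
From mathcomp Require Import all_classical all_reals all_analysis.

Set Implicit Arguments.
Unset Strict Implicit.
Unset Printing Implicit Defensive.

Import Order.TTheory GRing.Theory Num.Theory.
Import numFieldNormedType.Exports.

Local Open Scope ring_scope.
Local Open Scope classical_set_scope.

Section EuclideanSpace.
Context {R : realType} {N : nat}.
Implicit Types (u v : 'rV[R]_N) (S : set 'rV[R]_N).

Definition dot u v : R := \sum_(i < N) u 0 i * v 0 i.

Definition enorm u : R := Num.sqrt (dot u u).

Definition orth_compl S : set 'rV[R]_N :=
  [set v | forall w, S w -> dot v w = 0].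

Definition is_subspace_of_dim (k : nat) S : Prop :=
  exists2 W : {vspace 'rV[R]_N}, \dim W = k & S = [set v | v \in W].

Definition full S : Prop :=
  forall (q : 'rV[R]_N) (W : {vspace 'rV[R]_N}),
    (\dim W < N)%N -> ~ (S `<=` [set x | x - q \in W]).

End EuclideanSpace.

Section Smoothness.
Context {R : realType} {V W : normedModType R}.

Definition iter_derive (vs : seq V) (f : V -> W) : V -> W :=
  foldr (fun v g => 'D_v g) f vs.

(* f is C^oo on a neighbourhood of A.  For open A this is C^oo on A; for a
   closed interval it says that f|A is smooth up to the boundary and that the
   total function f is a smooth extension of f|A, so that the derivatives of f
   at the end points are the one-sided ones. *)
Definition smooth_on (A : set V) (f : V -> W) : Prop :=
  exists U : set V, [/\ open U, A `<=` U &
    forall (vs : seq V) x, U x -> differentiable (iter_derive vs f) x].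

End Smoothness.

Definition topological_embedding {S T : topologicalType}
    (A : set S) (f : S -> T) : Prop :=
  {within A, continuous f} /\
  exists2 g : T -> S,
    forall x, A x -> g (f x) = x & {within f @` A, continuous g}.

Section Curves.
Context {R : realType} {N : nat}.
Implicit Types (I : set R) (c : R -> 'rV[R]_N).

Definition velocity c : R -> 'rV[R]_N := c^`().

Definition acceleration c : R -> 'rV[R]_N := c^`(2).

Definition unit_speed_on I c : Prop := forall t, I t -> enorm (velocity c t) = 1.

Definition embedded_curve_on I c : Prop :=
  topological_embedding I c /\ forall t, I t -> velocity c t != 0.

(* Only meaningful for curves parametrized by arc length. *)
Definition curvature c (t : R) : R := enorm (acceleration c t).

End Curves.

Section Submanifolds.
Context {R : realType} {m N : nat}.
Implicit Types (M U : set 'rV[R]_N) (V : set 'rV[R]_m).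
Implicit Types (phi : 'rV[R]_m -> 'rV[R]_N).

Definition local_parametrization M U V phi : Prop :=
  [/\ open U, open V, phi @` V = M `&` U & topological_embedding V phi] /\
  [/\ smooth_on V phi & forall x, V x -> injective ('d phi x)].

Definition induced_metric phi (x : 'rV[R]_m) : 'M[R]_m :=
  \matrix_(i, j)
    dot ('D_(delta_mx 0 i) phi x) ('D_(delta_mx 0 j) phi x).

(* Christoffel symbol Gamma^k_ij of the metric g induced by phi:
   1/2 sum_l g^kl (d_i g_jl + d_j g_il - d_l g_ij). *)
Definition christoffel phi (k i j : 'I_m) (x : 'rV[R]_m) : R :=
  let g a b := fun y => induced_metric phi y a b in
  2^-1 * \sum_(l < m) invmx (induced_metric phi x) k l *
    ('D_(delta_mx 0 i) (g j l) x + 'D_(delta_mx 0 j) (g i l) x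
     - 'D_(delta_mx 0 l) (g i j) x).

Definition geodesic_equation phi (u : R -> 'rV[R]_m) (t : R) : Prop :=
  forall k : 'I_m,
    acceleration u t 0 k
    + \sum_(i < m) \sum_(j < m)
        christoffel phi k i j (u t) * velocity u t 0 i * velocity u t 0 j = 0.

End Submanifolds.

Section ExtrinsicGeometry.
Context {R : realType} {N : nat}.
Implicit Types (M : set 'rV[R]_N) (p x y w : 'rV[R]_N).

Definition embedded_submanifold (m : nat) M : Prop :=
  forall p, M p -> exists U (V : set 'rV[R]_m) phi,
    local_parametrization M U V phi /\ U p.

Definition tangent_space M p : set 'rV[R]_N :=
  [set v | exists (J : set R) (c : R -> 'rV[R]_N),
    [/\ open J, J 0, smooth_on J c & c @` J `<=` M] /\
    c 0 = p /\ velocity c 0 = v].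

(* Geodesic of the m-dimensional submanifold M for the induced metric: in
   coordinates, a solution u of the geodesic equation. *)
Definition geodesic_of (m : nat) M (I : set R) (c : R -> 'rV[R]_N) : Prop :=
  forall t0, I t0 ->
  exists U (V : set 'rV[R]_m) phi (J : set R) (u : R -> 'rV[R]_m),
    [/\ local_parametrization M U V phi, open J, J t0, smooth_on J u &
        u @` J `<=` V] /\
    forall t, I t -> J t -> c t = phi (u t) /\ geodesic_equation phi u t.

(* w is the normal component of D_x Y, where Y is a smooth tangent vector field
   of M near p with Y(p) = y.  Smoothness of Y on M and the derivative D_x Y are
   taken in a local parametrization phi, with phi(a) = p and dphi_a(u) = x. *)
Definition is_second_fundamental_form (m : nat) M p x y w : Prop :=
  exists U (V : set 'rV[R]_m) phi (Y : 'rV[R]_N -> 'rV[R]_N) (a u : 'rV[R]_m),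
    [/\ local_parametrization M U V phi, V a, phi a = p & 'd phi a u = x] /\
    [/\ smooth_on V (Y \o phi),
        forall q, (M `&` U) q -> tangent_space M q (Y q),
        Y p = y,
        tangent_space M p ('d (Y \o phi) a u - w) &
        orth_compl (tangent_space M p) w].

(* The value at p of the second fundamental form on x, y in T_pM, which does not
   depend on the choices in [is_second_fundamental_form]. *)
Definition second_fundamental_form (m : nat) M p x y : 'rV[R]_N :=
  get (is_second_fundamental_form m M p x y).

Definition nullity_space (m : nat) M p : set 'rV[R]_N :=
  [set x | tangent_space M p x /\
    forall y, tangent_space M p y -> second_fundamental_form m M p x y = 0].

Definition rank_one_submanifold (m : nat) M : Prop :=
  embedded_submanifold m M /\
  forall p, M p -> is_subspace_of_dim m.-1 (nullity_space m M p).

End ExtrinsicGeometry.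

(* Main.v *)
(* Write eta for the second derivative of gamma.  Transport D_0 along gamma by
   the orthogonal flow Phi of the skew field
   A = (eta^T eta' - eta'^T eta) / |eta|^2 (vectors are rows).  The transported
   space D_t stays orthogonal to eta, its derivative points in the direction of
   eta, and gamma' is itself transported, so that gamma'(t) lies in D_t.  If F
   is a transported basis of D_0 with first vector gamma', then F' = rho eta for
   a column rho with first entry 1, and the vectors Z_j = F_j - rho_j gamma'
   satisfy Z_j' = - rho_j' gamma'.  Hence
   phi(x) = gamma(x_0) + sum_(j > 0) x_j Z_j(x_0) has tangent space D_(x_0) along
   every ruling; its second fundamental form is x_0 y_0 times a nonzero multiple
   of eta, so phi parametrizes a rank-one submanifold near the curve, and gamma
   is a geodesic because eta is normal. *)
Require Import Defs.
From HB Require Import structures.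
From mathcomp Require Import all_boot all_order all_algebra.
From mathcomp Require Import all_classical all_reals all_analysis.
From mathcomp Require Import ring lra.

Set Implicit Arguments.
Unset Strict Implicit.
Unset Printing Implicit Defensive.

Import Order.TTheory GRing.Theory Num.Theory.
Import numFieldNormedType.Exports.

Local Open Scope ring_scope.
Local Open Scope classical_set_scope.

(** * Smoothness calculus *)

(** A submanifold needs an open parameter domain, and beyond the end points [gamma] is only some
    smooth extension of the curve: it need not have unit speed there, nor a velocity transported by
    the flow. The strip is therefore built on [delta], the integral of the transported axis started
    at [gamma 0]; it agrees with [gamma] on the interval, and its derivative is the axis at every
    time. The price is that the first entry of rho equals 1 on the interval only and is merely
    nonzero near it.

    Embeddedness rests on one inequality. The strip map is immersive and injective on the compact
    axis, so [r * |x - y| <= |phi x - phi y|] holds on a whole neighbourhood of it. This gives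
    injectivity, continuity of the inverse, immersivity on that neighbourhood, and differentiable
    coordinates for every differentiable curve in M. Fullness passes from the curve to M. The
    geodesic equation, being stated in coordinates, is verified from the first derivatives of the
    metric along the axis. *)

Section MatrixCalculus.
Context {R : realType} {V : normedModType R}.

Lemma differentiable_mxP (m n : nat) (M : V -> 'M[R]_(m, n)) x :
  differentiable M x <-> forall i j, differentiable (fun y => M y i j) x.
Proof.
split=> [dM i j|dM].
  exact: (differentiable_comp dM (differentiable_coord _ i j)).
have -> : M = \sum_(i < m) \sum_(j < n) (fun y => M y i j *: delta_mx i j).
  apply/funext => y; rewrite fct_sumE [LHS]matrix_sum_delta.
  by apply: eq_bigr => i _; rewrite fct_sumE.
apply: differentiable_sum => i; apply: differentiable_sum => j.
exact: differentiableZl.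
Qed.

Lemma is_derive_mxP (m n : nat) (M : V -> 'M[R]_(m, n)) x v D :
  is_derive x v M D <-> forall i j, is_derive x v (fun y => M y i j) (D i j).
Proof.
split=> [[dM <-] i j|dM].
  split; first exact: (derivable_mxP M x v).1.
  by rewrite derive_mx// mxE.
have dM1 : derivable M x v by apply/derivable_mxP => i j; case: (dM i j).
split=> //; rewrite derive_mx//; apply/matrixP => i j.
by rewrite mxE; case: (dM i j).
Qed.

Lemma is_derive_mulmx (m n p : nat) (f : V -> 'M[R]_(m, n))
    (g : V -> 'M[R]_(n, p)) x v df dg :
  is_derive x v f df -> is_derive x v g dg ->
  is_derive x v (fun y => f y *m g y) (df *m g x + f x *m dg).
Proof.
move=> /is_derive_mxP Hf /is_derive_mxP Hg; apply/is_derive_mxP => i j.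
have -> : (fun y => (f y *m g y) i j) =
    \sum_(k < n) ((fun y => f y i k) * (fun y => g y k j)).
  by apply/funext => y; rewrite fct_sumE mxE.
have Hk k := is_deriveM (Hf i k) (Hg k j).
apply: is_derive_eq (is_derive_sum Hk) _.
rewrite !mxE -big_split/=; apply: eq_bigr => k _.
by rewrite addrC /GRing.scale/= [g x k j * _]mulrC.
Qed.

Lemma is_derive_trmx (m n : nat) (f : V -> 'M[R]_(m, n)) x v df :
  is_derive x v f df -> is_derive x v (fun y => (f y)^T) df^T.
Proof.
move=> /is_derive_mxP Hf; apply/is_derive_mxP => i j.
have -> : (fun y => (f y)^T i j) = (fun y => f y j i).
  by apply/funext => y; rewrite mxE.
by rewrite mxE.
Qed.

Lemma is_derive_scalemx (m n : nat) (k : V -> R) (f : V -> 'M[R]_(m, n))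
    x v dk df :
  is_derive x v k dk -> is_derive x v f df ->
  is_derive x v (fun y => k y *: f y) (dk *: f x + k x *: df).
Proof.
move=> Hk /is_derive_mxP Hf; apply/is_derive_mxP => i j.
have -> : (fun y => (k y *: f y) i j) = k * (fun y => f y i j).
  by apply/funext => y; rewrite mxE.
apply: is_derive_eq (is_deriveM Hk (Hf i j)) _.
by rewrite !mxE addrC /GRing.scale/= [f x i j * _]mulrC.
Qed.

Lemma is_derive_diff (W : normedModType R) (f : V -> W) x v :
  differentiable f x -> is_derive x v f ('d f x v).
Proof. by move=> df; rewrite -deriveE//; exact/derivableP/diff_derivable. Qed.

End MatrixCalculus.

Section NearEqual.
Context {R : realType} {V W : normedModType R}.

Lemma near_eq_differentiable (f g : V -> W) x :
  (\forall y \near x, f y = g y) -> differentiable f x -> differentiable g x.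
Proof.
move=> fg /diff_locallyP[cdf fE].
have gE : g \o shift x = cst (g x) + 'd f x +o_ 0 id.
  apply/eqaddoP => e e0; move/eqaddoP : fE => /(_ _ e0).
  have : \forall h \near 0, f (h + x) = g (h + x).
    by move: (fg); rewrite (near_shift 0)/= subr0.
  apply: filterS2 => h E.
  suff -> : (f \o shift x - (cst (f x) + 'd f x)) h =
            (g \o shift x - (cst (g x) + 'd f x)) h by [].
  by rewrite !fctE /= E (nbhs_singleton fg).
have dE := diff_unique cdf gE.
by apply/diff_locallyP; rewrite dE.
Qed.

End NearEqual.

Section IteratedDifferentiability.
Context {R : realType}.

(* [Ck k] asks for k + 1 differentiations: [smooth_on] is [Ck k] for all k on an
   open neighbourhood. *)
Fixpoint Ck {V W : normedModType R} k (U : set V) (f : V -> W) : Prop :=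
  (forall x, U x -> differentiable f x) /\
  if k is k'.+1 then forall v, @Ck V W k' U ('D_v f) else True.

Section General.
Context {V W : normedModType R}.
Implicit Types (U A : set V) (f g : V -> W).

Lemma Ck_differentiable k U f x : Ck k U f -> U x -> differentiable f x.
Proof. by case: k => [|k] [df _]; exact: df. Qed.

Lemma Ck_derive k U f v : Ck k.+1 U f -> Ck k U ('D_v f).
Proof. by case=> _; apply. Qed.

Lemma Ck_pred k U f : Ck k.+1 U f -> Ck k U f.
Proof.
elim: k f => [|k IH] f [df Df]; split=> // v.
exact: IH (Df v).
Qed.

Lemma Ck_subset k U A f : A `<=` U -> Ck k U f -> Ck k A f.
Proof.
move=> AU; elim: k f => [|k IH] f [df Df]; first by split=> // x /AU/df.
by split=> [x /AU/df //|v]; exact: IH (Df v).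
Qed.

Lemma near_open_eq U f g x : open U -> U x -> (forall y, U y -> f y = g y) ->
  \forall y \near x, f y = g y.
Proof.
by move=> oU Ux fg; apply: filterS fg _; exact: open_nbhs_nbhs.
Qed.

Lemma Ck_eq k U f g : open U -> (forall x, U x -> f x = g x) ->
  Ck k U f -> Ck k U g.
Proof.
move=> oU; elim: k f g => [|k IH] f g fg [df Df]; have dg x : U x -> differentiable g x.
- by move=> Ux; exact: near_eq_differentiable (near_open_eq oU Ux fg) (df x Ux).
- by split.
- by move=> Ux; exact: near_eq_differentiable (near_open_eq oU Ux fg) (df x Ux).
- split=> // v; apply: IH (Df v) => x Ux; apply: near_eq_derive.
  exact: near_open_eq oU Ux fg.
Qed.

Lemma Ck_cst k U (a : W) : Ck k U (fun=> a).
Proof.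
elim: k a => [|k IH] a.
  by split=> // x _; exact: differentiable_cst.
split=> [x _|v]; first exact: differentiable_cst.
suff -> : 'D_v (fun=> a) = (fun=> 0) :> (V -> W) by exact: IH.
by apply/funext => x; rewrite (derive_cst a).
Qed.

Lemma Ck_add k U f g : open U -> Ck k U f -> Ck k U g ->
  Ck k U (fun x => f x + g x).
Proof.
move=> oU; elim: k f g => [|k IH] f g [df Df] [dg Dg].
  by split=> // x Ux; apply: differentiableD; [exact: df|exact: dg].
split=> [x Ux|v]; first by apply: differentiableD; [exact: df|exact: dg].
apply: Ck_eq oU _ (IH _ _ (Df v) (Dg v)) => x Ux; rewrite -deriveD//.
- by apply: diff_derivable; exact: df.
- by apply: diff_derivable; exact: dg.
Qed.

Lemma Ck_scale k U (c : R) f : open U -> Ck k U f -> Ck k U (fun x => c *: f x).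
Proof.
move=> oU; elim: k f => [|k IH] f [df Df].
  by split=> // x Ux; apply: differentiableZ; exact: df.
split=> [x Ux|v]; first by apply: differentiableZ; exact: df.
apply: Ck_eq oU _ (IH _ (Df v)) => x Ux; rewrite -deriveZ//.
by apply: diff_derivable; exact: df.
Qed.

Lemma Ck_sum k U n (F : 'I_n -> V -> W) : open U ->
  (forall i, Ck k U (F i)) -> Ck k U (fun x => \sum_(i < n) F i x).
Proof.
move=> oU; elim: n F => [|n IH] F HF.
  apply: Ck_eq oU _ (Ck_cst k U 0) => x _; by rewrite big_ord0.
apply: Ck_eq oU _ (Ck_add oU (IH (fun i => F (widen_ord (leqnSn n) i)) _)
  (HF ord_max)) => // x _.
by rewrite big_ord_recr.
Qed.

Lemma iter_derive_rcons vs v f :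
  iter_derive (rcons vs v) f = iter_derive vs ('D_v f).
Proof. by rewrite /iter_derive foldr_rcons. Qed.

(** In [iter_derive] the last vector of the list is differentiated first, and [Ck] also peels off
    the innermost derivative; hence the induction on lists from the right. *)
Lemma smooth_onP A f :
  smooth_on A f <->
  exists U, [/\ open U, A `<=` U & forall k, Ck k U f].
Proof.
split=> -[U [oU AU HU]]; exists U; split=> //.
- move=> k; elim: k f HU => [|k IH] f HU; first by split=> // x; exact: (HU [::]).
  split=> [x|v]; first exact: (HU [::]).
  by apply: IH => vs x Ux; rewrite -iter_derive_rcons; exact: HU.
- move=> vs; elim/last_ind: vs f HU => [|vs v IH] f HU x Ux.
    exact: Ck_differentiable (HU 0%N) Ux.
  rewrite iter_derive_rcons; apply: IH Ux => k.
  exact: Ck_derive (HU k.+1).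
Qed.

End General.

Section Real.
Context {V : normedModType R}.
Implicit Types (U : set V) (f g : V -> R).

Lemma Ck_mul k U f g : open U -> Ck k U f -> Ck k U g ->
  Ck k U (fun x => f x * g x).
Proof.
move=> oU; elim: k f g => [|k IH] f g.
  move=> [df Df] [dg Dg].
  by split=> // x Ux; apply: differentiableM; [exact: df|exact: dg].
move=> Cf Cg; have [[df Df] [dg Dg]] := (Cf, Cg).
split=> [x Ux|v]; first by apply: differentiableM; [exact: df|exact: dg].
apply: Ck_eq oU _ (Ck_add oU (IH _ _ (Ck_pred Cf) (Dg v))
  (IH _ _ (Ck_pred Cg) (Df v))) => x Ux.
rewrite deriveM//; first by apply: diff_derivable; exact: df.
by apply: diff_derivable; exact: dg.
Qed.

(** The derivative is [- f' / f ^ 2], whose factors [1 / f] are covered by the induction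
    hypothesis. *)
Lemma Ck_inv k U f : open U -> (forall x, U x -> f x != 0) -> Ck k U f ->
  Ck k U (fun x => (f x)^-1).
Proof.
move=> oU f0; elim: k => [|k IH] Cf.
  split=> // x Ux; apply: differentiableV; last exact: f0.
  exact: Ck_differentiable Cf Ux.
have [df Df] := Cf; have Ci := IH (Ck_pred Cf).
split=> [x Ux|v]; first by apply: differentiableV; [exact: df|exact: f0].
apply: Ck_eq oU _ (Ck_scale (-1) oU (Ck_mul oU (Ck_mul oU Ci Ci) (Df v)))
  => x Ux.
rewrite deriveV ?f0//; last by apply: diff_derivable; exact: df.
by rewrite scaleN1r -exprVn expr2 -mulNr.
Qed.

End Real.

Section Matrix.
Context {V : normedModType R}.
Implicit Types (U : set V).

Lemma Ck_mxP k U (m n : nat) (M : V -> 'M[R]_(m, n)) : open U ->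
  Ck k U M <-> forall i j, Ck k U (fun x => M x i j).
Proof.
move=> oU; elim: k M => [|k IH] M.
  split=> [[dM _] i j|dM]; split=> // x Ux.
    exact: (differentiable_mxP M x).1 (dM x Ux) i j.
  by apply/differentiable_mxP => i j; case: (dM i j) => + _; apply.
have DE v : (forall x, U x -> differentiable M x) ->
    forall i j x, U x -> 'D_v (fun y => M y i j) x = 'D_v M x i j.
  move=> dM i j x Ux; rewrite [in RHS]derive_mx ?mxE//.
  exact/diff_derivable/dM.
split=> [[dM DM] i j|CM].
  split=> [x Ux|v]; first exact: (differentiable_mxP M x).1 (dM x Ux) i j.
  by apply: Ck_eq oU _ ((IH _).1 (DM v) i j) => x Ux; rewrite DE.
have dM x : U x -> differentiable M x.
  by move=> Ux; apply/differentiable_mxP => i j; case: (CM i j) => + _; apply.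
split=> // v; apply/IH => i j; case: (CM i j) => _ /(_ v).
by apply: Ck_eq => // x Ux; rewrite DE.
Qed.

Lemma Ck_mulmx k U (m n p : nat) (f : V -> 'M[R]_(m, n))
    (g : V -> 'M[R]_(n, p)) : open U ->
  Ck k U f -> Ck k U g -> Ck k U (fun x => f x *m g x).
Proof.
move=> oU /(Ck_mxP _ _ oU) Cf /(Ck_mxP _ _ oU) Cg; apply/(Ck_mxP _ _ oU) => i j.
have Cs : Ck k U (fun x => \sum_(l < n) f x i l * g x l j).
  by apply: Ck_sum => // l; exact: Ck_mul.
by apply: Ck_eq oU _ Cs => x _; rewrite mxE.
Qed.

Lemma Ck_trmx k U (m n : nat) (f : V -> 'M[R]_(m, n)) : open U ->
  Ck k U f -> Ck k U (fun x => (f x)^T).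
Proof.
move=> oU /(Ck_mxP _ _ oU) Cf; apply/(Ck_mxP _ _ oU) => i j.
by apply: Ck_eq oU _ (Cf j i) => x _; rewrite mxE.
Qed.

Lemma Ck_scalemx k U (m n : nat) (c : V -> R) (f : V -> 'M[R]_(m, n)) :
  open U -> Ck k U c -> Ck k U f -> Ck k U (fun x => c x *: f x).
Proof.
move=> oU Cc /(Ck_mxP _ _ oU) Cf; apply/(Ck_mxP _ _ oU) => i j.
by apply: Ck_eq oU _ (Ck_mul oU Cc (Cf i j)) => x _; rewrite mxE.
Qed.

End Matrix.

Section Affine.
Context {V W V1 : normedModType R}.

(** The differential of the inner map is the same at all points, so a directional derivative of
    [f \o p] is again a directional derivative of [f] composed with [p], and the induction closes
    without products. Coordinates and parametrized lines are the inner maps in use. *)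
Lemma Ck_comp_affine k (U : set V1) (U' : set V) (p : V -> V1) (c : V -> V1)
    (f : V1 -> W) :
  open U' -> (forall x, U' x -> U (p x)) ->
  (forall x, differentiable p x) -> (forall x v, 'd p x v = c v) ->
  Ck k U f -> Ck k U' (f \o p).
Proof.
move=> oU' pU dp Dp; elim: k f => [|k IH] f [df Df].
  by split=> // x /pU Ux; apply: differentiable_comp => //; exact: df.
have dfp x : U' x -> differentiable (f \o p) x.
  by move=> /pU Ux; apply: differentiable_comp => //; exact: df.
split=> // v; apply: Ck_eq oU' _ (IH _ (Df (c v))) => x Ux /=.
rewrite [RHS]deriveE; last exact: dfp.
rewrite diff_comp//=; last exact/df/pU.
by rewrite Dp -deriveE//; exact/df/pU.
Qed.

End Affine.

Section Curve.
Context {W : normedModType R}.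
Implicit Types (U : set R) (f : R -> W).

Lemma Ck_derive1 k U f : Ck k.+1 U f -> Ck k U f^`().
Proof.
move=> /(Ck_derive (1 : R)); suff -> : f^`() = 'D_1 f by [].
by apply/funext => t; rewrite derive1E.
Qed.

Lemma is_derive1_differentiable f (t : R) df : is_derive t 1 f df ->
  differentiable f t.
Proof. by case=> d _; exact/derivable1_diffP. Qed.

(** Bootstraps the smoothness of solutions of differential equations: on the line, a derivative in
    direction v is v times the ordinary one. *)
Lemma CkS_is_derive k U f df : open U ->
  (forall t : R, U t -> is_derive t 1 f (df t)) -> Ck k U df -> Ck k.+1 U f.
Proof.
move=> oU Hf Cdf; split=> [t Ut|v].
  exact: is_derive1_differentiable (Hf t Ut).
apply: Ck_eq oU _ (Ck_scale v oU Cdf) => t Ut.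
have dt := is_derive1_differentiable (Hf t Ut).
case: (Hf t Ut) => d <-; rewrite !deriveE//.
by rewrite -linearZ /= /GRing.scale/= mulr1.
Qed.

Lemma Ck_is_derive k U f (t : R) : Ck k U f -> U t -> is_derive t 1 f (f^`() t).
Proof.
move=> Cf Ut; split; last by rewrite derive1E.
exact/diff_derivable/(Ck_differentiable Cf).
Qed.

End Curve.
End IteratedDifferentiability.

(** * The sup norm of matrices and mean value estimates *)

Section MatrixNorm.
Context {R : realType}.

Lemma mx_norm_entry (m n : nat) (M : 'M[R]_(m, n)) i j : `|M i j| <= `|M|.
Proof.
by rewrite [leRHS]/Num.Def.normr/= mx_normrE; exact: (le_bigmax _ _ (i, j)).
Qed.

Lemma mx_norm_le (m n : nat) (M : 'M[R]_(m, n)) c : 0 <= c ->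
  (forall i j, `|M i j| <= c) -> `|M| <= c.
Proof.
move=> c0 Mc; rewrite [leLHS]/Num.Def.normr/= mx_normrE.
by apply: bigmax_le => // -[i j] _; exact: Mc.
Qed.

Lemma mulmx_norm_le (m n p : nat) (A : 'M[R]_(m, n)) (B : 'M[R]_(n, p)) :
  `|A *m B| <= n%:R * `|A| * `|B|.
Proof.
apply: mx_norm_le => [|i j]; first by rewrite !mulr_ge0.
rewrite mxE; apply: le_trans (ler_norm_sum _ _ _) _.
rewrite -mulrA mulr_natl -[X in _ *+ X]card_ord -sumr_const.
by apply: ler_sum => k _; rewrite normrM ler_pM// mx_norm_entry.
Qed.

(** The mean value theorem is applied to each entry separately; for the sup norm this loses no
    constant. *)
Lemma derive_bound_lipschitz (m n : nat) (f df : R -> 'M[R]_(m, n)) (a b C : R) :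
  (forall t, a <= t <= b -> is_derive t 1 f (df t)) ->
  (forall t, a <= t <= b -> `|df t| <= C) ->
  forall x y, a <= x <= b -> a <= y <= b -> `|f x - f y| <= C * `|x - y|.
Proof.
move=> Hf HC.
have main x y : a <= x <= b -> a <= y <= b -> x <= y ->
    `|f y - f x| <= C * `|y - x|.
  move=> /[dup] xab /andP[ax _] /andP[_ yb] xy.
  have sub t : t \in `[x, y]%R -> a <= t <= b.
    by rewrite in_itv/= => /andP[xt ty]; rewrite (le_trans ax xt) (le_trans ty yb).
  have C0 : 0 <= C by exact: le_trans (normr_ge0 _) (HC _ xab).
  apply: mx_norm_le => [|i j]; first exact: mulr_ge0.
  have Hij t : t \in `[x, y]%R ->
      is_derive t 1 (fun s => f s i j) (df t i j).
    by move=> /sub/Hf/is_derive_mxP; apply.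
  have cf : {within `[x, y], continuous (fun s => f s i j)}.
    by apply: derivable_within_continuous => t /Hij[].
  have Hoo t : t \in `]x, y[%R -> is_derive t 1 (fun s => f s i j) (df t i j).
    by move=> txy; apply: Hij; exact: subset_itv_oo_cc txy.
  have [c cxy E] := MVT_segment xy Hoo cf.
  rewrite !mxE E normrM ler_wpM2r//.
  exact: le_trans (mx_norm_entry _ _ _) (HC _ (sub _ cxy)).
move=> x y xab yab; have [xy|/ltW yx] := leP x y; last exact: main.
by rewrite distrC [`|x - y|]distrC; exact: main.
Qed.

Lemma derive0_constant (m n : nat) (f : R -> 'M[R]_(m, n)) (a b : R) :
  (forall t, a <= t <= b -> is_derive t 1 f 0) ->
  forall x y, a <= x <= b -> a <= y <= b -> f x = f y.
Proof.
move=> Hf x y xab yab; apply/eqP; rewrite -subr_eq0 -normr_le0.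
rewrite -(mul0r `|x - y|).
by apply: derive_bound_lipschitz Hf _ _ _ xab yab => t _; rewrite normr0.
Qed.

End MatrixNorm.

(** * Antiderivatives on the whole line *)

Section Antiderivative.
Context {R : realType}.

Lemma antiderivative_right (f : R -> R) (a : R) : continuous f ->
  exists F : R -> R, forall t, a < t -> is_derive t 1 F (f t).
Proof.
move=> cf; exists (fun t => \int[lebesgue_measure]_(s in `[a, t]) f s)%R.
move=> t at1.
have tt1 : t < t + 1 by rewrite ltrDl.
have fi : lebesgue_measure.-integrable `[a, t + 1] (EFin \o f).
  apply: continuous_compact_integrable; first exact: segment_compact.
  exact: continuous_subspaceT.
have [d e] := continuous_FTC1_closed tt1 fi at1 (cf t).
exact: DeriveDef d (etrans (esym (derive1E _ _)) e).
Qed.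

(** An integral from -1 is an antiderivative to the right of -1 only. Reflecting the time gives one
    to the left of 1. Both are normalized to vanish at 0, agree on the overlap, and are glued at
    0. *)
Lemma antiderivative_real (f : R -> R) : continuous f ->
  exists F : R -> R, F 0 = 0 /\ forall t : R, is_derive t 1 F (f t).
Proof.
move=> cf.
have [F1 HF1] := antiderivative_right (-1) cf.
have cg : continuous (fun t => f (- t)).
  by move=> t; apply: continuous_comp; [exact: oppr_continuous|exact: cf].
have [F2 HF2] := antiderivative_right (-1) cg.
pose G1 t := F1 t - F1 0; pose G2 t := F2 0 - F2 (- t).
have HG1 (t : R) : -1 < t -> is_derive t 1 G1 (f t).
  move=> t1; have H1 := HF1 t t1.
  have := is_deriveB H1 (is_derive_cst (F1 0) _ _).
  by rewrite subr0.
have HG2 (t : R) : t < 1 -> is_derive t 1 G2 (f t).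
  move=> t1.
  have H2 : is_derive (- t) 1 F2 (f t).
    by rewrite -[X in f X]opprK; apply: HF2; rewrite ltrN2.
  have H3 := is_derive1_comp H2 (is_deriveNid t 1).
  have := is_deriveB (is_derive_cst (F2 0) _ _) H3.
  by rewrite mulrN mulr1 sub0r opprK.
have E12 (t : R) : -1 < t < 1 -> G1 t = G2 t.
  (* The difference is viewed as a 1 x 1 matrix to apply [derive0_constant] on a closed interval
     [[- l, l]] inside the overlap that contains both t and 0. *)
  move=> /andP[t1 t2]; pose M s : 'M[R]_1 := const_mx (G1 s - G2 s).
  have [l lt1 [l1 l2]] : exists2 l, 0 < l < 1 & - l <= t /\ t <= l.
    have := ler_norm t; have := ler_norm (- t); rewrite normrN => tN tp.
    have : `|t| < 1 by rewrite ltr_norml t1.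
    have := normr_ge0 t.
    by exists ((1 + `|t|) / 2); [apply/andP|]; split; lra.
  have HM (s : R) : - l <= s <= l -> is_derive s 1 M 0.
    move=> /andP[s1 s2]; apply/is_derive_mxP => i j; rewrite mxE.
    have -> : (fun y => M y i j) = G1 - G2 by apply/funext => y; rewrite mxE.
    rewrite -(subrr (f s)).
    by apply: is_deriveB; [apply: HG1|apply: HG2]; lra.
  have := derive0_constant HM (x := t) (y := 0).
  move=> /(_ _ _)/matrixP/(_ 0 0); rewrite !mxE.
  rewrite /G1 /G2 oppr0 !subrr => E; apply/eqP; rewrite -subr_eq0 E//; lra.
exists (fun t => if t < 0 then G2 t else G1 t); split.
  by rewrite ltxx /G1 subrr.
move=> t; have [t1|t1] := ltP t 1.
  apply: near_eq_is_derive (HG2 t t1); near=> s; case: ltP => // s0.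
  rewrite E12//; apply/andP; split; first by lra.
  by near: s; exact: lt_nbhsl.
have t2 : 0 < t by lra.
apply: near_eq_is_derive (HG1 t _); last by lra.
near=> s; rewrite ltNge.
by rewrite ltW//; near: s; exact: lt_nbhsr.
Unshelve. all: by end_near. Qed.

Lemma antiderivative (m n : nat) (f : R -> 'M[R]_(m, n)) : continuous f ->
  exists F : R -> 'M[R]_(m, n), F 0 = 0 /\ forall t : R, is_derive t 1 F (f t).
Proof.
move=> cf.
have cfij i j : continuous (fun t => f t i j).
  move=> t; apply: (@continuous_comp _ _ _ f (fun M : 'M[R]_(m, n) => M i j)).
    exact: cf.
  exact: coord_continuous.
pose F i j := sval (cid (antiderivative_real (cfij i j))).
have HF i j : F i j 0 = 0 /\ forall t : R, is_derive t 1 (F i j) (f t i j).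
  by rewrite /F; case: cid.
exists (fun t => \matrix_(i, j) F i j t); split.
  by apply/matrixP => i j; rewrite !mxE (HF i j).1.
move=> t; apply/is_derive_mxP => i j.
have -> : (fun y => (\matrix_(i0, j0) F i0 j0 y) i j) = F i j.
  by apply/funext => y; rewrite mxE.
exact: (HF i j).2.
Qed.

End Antiderivative.

(** * Linear differential equations *)

Section LinearODE.
Context {R : realType}.

(** For each entry of f, both its sum with g and its difference from g are nondecreasing. *)
Lemma derive_norm_le (m n : nat) (f df : R -> 'M[R]_(m, n)) (g dg : R -> R)
    (a b : R) : a <= b ->
  (forall t, a <= t <= b -> is_derive t 1 f (df t)) ->
  (forall t, a <= t <= b -> is_derive t 1 g (dg t)) ->
  (forall t, a <= t <= b -> `|df t| <= dg t) ->
  `|f b - f a| <= g b - g a.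
Proof.
move=> ab Hf Hg Hle.
have sub t : t \in `[a, b]%R -> a <= t <= b by rewrite in_itv.
have main (h dh : R -> R) : (forall t, a <= t <= b -> is_derive t 1 h (dh t)) ->
    (forall t, a <= t <= b -> 0 <= dh t) -> 0 <= h b - h a.
  move=> Hh h0.
  have ch : {within `[a, b], continuous h}.
    by apply: derivable_within_continuous => t /sub/Hh[].
  have Hoo t : t \in `]a, b[%R -> is_derive t 1 h (dh t).
    by move=> tab; apply/Hh/sub; exact: subset_itv_oo_cc tab.
  have [c cab ->] := MVT_segment ab Hoo ch.
  by rewrite mulr_ge0 ?subr_ge0// h0// sub.
have g0 : 0 <= g b - g a.
  by apply: main Hg _ => t tab; exact: le_trans (normr_ge0 _) (Hle t tab).
apply: mx_norm_le => // i j; rewrite !mxE ler_norml.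
have Hij t : a <= t <= b -> is_derive t 1 (fun s => f s i j) (df t i j).
  by move=> /Hf/is_derive_mxP; apply.
have Hb t : a <= t <= b -> `|df t i j| <= dg t.
  by move=> tab; exact: le_trans (mx_norm_entry _ _ _) (Hle t tab).
have := main _ _ (fun t h => is_deriveD (Hg t h) (Hij t h)).
have := main _ _ (fun t h => is_deriveB (Hg t h) (Hij t h)).
rewrite !fctE => H1 H2.
have {}H1 : 0 <= g b - f b i j - (g a - f a i j).
  by apply: H1 => t /Hb; rewrite ler_norml => /andP[]; lra.
have {}H2 : 0 <= g b + f b i j - (g a + f a i j).
  by apply: H2 => t /Hb; rewrite ler_norml => /andP[]; lra.
by apply/andP; split; lra.
Qed.

Lemma is_derive_expR_scale (c t : R) :
  is_derive t 1 (fun s : R => expR (c * s)) (c * expR (c * t)).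
Proof.
have H : is_derive t 1 (fun s : R => c * s) c.
  have := is_deriveZ c (is_derive_id t (1 : R)).
  by rewrite /GRing.scale/= mulr1.
have := is_derive1_comp (is_derive_expR (c * t)) H.
by rewrite mulrC.
Qed.

(* Integration shrinks the weighted norm sup_t |f t| exp(-2K|t|) by 2K, which
   makes the Picard iteration a contraction on the whole line. *)
Lemma derive_exp_bound (m n : nat) (f df : R -> 'M[R]_(m, n)) (B K : R) :
  0 < K -> 0 <= B -> f 0 = 0 ->
  (forall t : R, is_derive t 1 f (df t)) ->
  (forall t, `|df t| <= K * B * expR (2 * K * `|t|)) ->
  forall t, `|f t| <= B / 2 * expR (2 * K * `|t|).
Proof.
move=> K0 B0 f0 Hf Hdf t.
have [t0|t0] := leP 0 t.
  have Hg (s : R) : is_derive s 1 (fun s => B / 2 * expR (2 * K * s))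
      (K * B * expR (2 * K * s)).
    have := is_deriveZ (B / 2) (is_derive_expR_scale (2 * K) s).
    rewrite /GRing.scale/=; congr (is_derive _ _ _ _).
    by field.
  have := derive_norm_le t0 (fun s _ => Hf s) (fun s _ => Hg s).
  rewrite f0 subr0 (ger0_norm t0) mulr0 expR0 => H.
  apply: le_trans (H _) _; last by rewrite lerBlDr lerDl mulr1 divr_ge0.
  by move=> s /andP[s0 _]; have := Hdf s; rewrite (ger0_norm s0).
have Hg (s : R) : is_derive s 1 (fun s => - (B / 2) * expR (- (2 * K) * s))
    (K * B * expR (- (2 * K) * s)).
  have := is_deriveZ (- (B / 2)) (is_derive_expR_scale (- (2 * K)) s).
  rewrite /GRing.scale/=; congr (is_derive _ _ _ _).
  by field.
have := derive_norm_le (ltW t0) (fun s _ => Hf s) (fun s _ => Hg s).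
rewrite f0 sub0r normrN (ltr0_norm t0) mulr0 expR0 => H.
apply: le_trans (H _) _.
  by move=> s /andP[_ s0]; have := Hdf s; rewrite (ler0_norm s0) mulrN mulNr.
rewrite mulrN mulNr; have := divr_ge0 B0 (ler0n R 2).
by rewrite !mulNr mulr1; lra.
Qed.

Lemma geometric_cauchy_limit_real (u : nat -> R) (c : R) :
  (forall k, `|u k.+1 - u k| <= c * 2^-1 ^+ k) ->
  exists l, forall k, `|l - u k| <= 2 * c * 2^-1 ^+ k.
Proof.
move=> Hu; have c0 : 0 <= c.
  by have := le_trans (normr_ge0 _) (Hu 0%N); rewrite expr0 mulr1.
have uB k j : `|u (j + k)%N - u k| <= 2 * c * 2^-1 ^+ k.
  (* The exact geometric sum of the first j increments after k; the weaker bound would not survive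
     the induction. *)
  suff H : `|u (j + k)%N - u k| <= 2 * c * 2^-1 ^+ k * (1 - 2^-1 ^+ j).
    apply: le_trans H _; apply: ler_piMr; last by rewrite gerBl exprn_ge0.
    by rewrite !mulr_ge0// exprn_ge0.
  elim: j => [|j IH]; first by rewrite add0n !subrr normr0 mulr0.
  rewrite -(subrKA (u (j + k)%N)) addSn.
  apply: le_trans (ler_normD _ _) _; apply: le_trans (lerD (Hu _) IH) _.
  by rewrite exprD exprS le_eqVlt; apply/orP; left; apply/eqP; field.
have : cvgn (series (fun k => u k.+1 - u k)).
  apply: normed_cvg; apply: (series_le_cvg _ _ _ (@is_cvg_geometric_series R c 2^-1 _)).
  - by move=> k /=.
  - by move=> k; rewrite /geometric/= mulr_ge0// exprn_ge0.
  - by move=> k; exact: (Hu k).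
  - by rewrite ger0_norm// invf_lt1// ltr1n.
(* The series of increments telescopes to the sequence minus its initial term, which is added
   back. *)
move=> /cvg_ex[/= s /cvgrPdist_lt Hs]; exists (s + u 0%N) => k.
apply/ler_addgt0Pl => e e0.
have [j _ Hj] := Hs e e0.
have := Hj (j + k)%N (leq_addr _ _); rewrite seriesEnat/= telescope_sumr// => H.
rewrite -(subrKA (u (j + k)%N)); apply: le_trans (ler_normD _ _) _.
apply: lerD (uB _ _); apply: ltW; move: H.
by rewrite opprB addrA.
Qed.

Lemma geometric_cauchy_limit (m n : nat) (u : nat -> 'M[R]_(m, n)) (c : R) :
  (forall k, `|u k.+1 - u k| <= c * 2^-1 ^+ k) ->
  exists l, forall k, `|l - u k| <= 2 * c * 2^-1 ^+ k.
Proof.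
move=> Hu; have c0 : 0 <= c.
  by have := le_trans (normr_ge0 _) (Hu 0%N); rewrite expr0 mulr1.
have Hij i j k : `|u k.+1 i j - u k i j| <= c * 2^-1 ^+ k.
  by have := le_trans (mx_norm_entry _ i j) (Hu k); rewrite !mxE.
pose l i j := sval (cid (geometric_cauchy_limit_real (Hij i j))).
exists (\matrix_(i, j) l i j) => k; apply: mx_norm_le => [|i j].
  by rewrite !mulr_ge0// exprn_ge0.
by rewrite !mxE /l; case: cid.
Qed.

End LinearODE.

Section MatrixLimits.
Context {R : realType}.

Lemma cvg_mx (T : Type) (F : set_system T) (m n : nat) (f : T -> 'M[R]_(m, n))
    (l : 'M[R]_(m, n)) : Filter F ->
  (forall i j, f x i j @[x --> F] --> l i j) -> f @ F --> l.
Proof.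
move=> FF Hf; apply/cvgrPdist_le => e e0.
have : \forall x \near F, forall i j, `|l i j - f x i j| <= e.
  apply: filter_forall => i; apply: filter_forall => j.
  exact: (cvgrPdist_le _ _).1 (Hf i j) e e0.
apply: filterS => x Hx; apply: mx_norm_le => [|i j]; first exact: ltW.
by rewrite !mxE.
Qed.

Lemma cvg_mx_entry (T : Type) (F : set_system T) (m n : nat)
    (f : T -> 'M[R]_(m, n)) (l : 'M[R]_(m, n)) i j : Filter F ->
  f @ F --> l -> f x i j @[x --> F] --> l i j.
Proof.
move=> FF Hf; apply/cvgrPdist_le => e e0.
have : \forall x \near F, `|l - f x| <= e.
  exact: (cvgrPdist_le _ _).1 Hf e e0.
apply: filterS => x Hx; apply: le_trans _ Hx.
by have := mx_norm_entry (l - f x) i j; rewrite !mxE.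
Qed.

Lemma cvg_mulmx (T : Type) (F : set_system T) (m n p : nat)
    (f : T -> 'M[R]_(m, n)) (g : T -> 'M[R]_(n, p))
    (a : 'M[R]_(m, n)) (b : 'M[R]_(n, p)) :
  Filter F ->
  f @ F --> a -> g @ F --> b -> f x *m g x @[x --> F] --> a *m b.
Proof.
move=> FF fa gb; apply: cvg_mx => i j.
rewrite mxE; under eq_fun do rewrite mxE.
apply: cvg_big => [|k _]; first exact: add_continuous.
by apply: cvgM; exact: cvg_mx_entry.
Qed.

End MatrixLimits.

Section LinearODEExistence.
Context {R : realType}.

Lemma exists_half_pow_lt (c e : R) : 0 < e -> exists k, c * 2^-1 ^+ k < e.
Proof.
move=> e0.
have : (c * 2^-1 ^+ k) @[k --> \oo] --> (0 : R).
  rewrite -[X in _ --> X](mulr0 c); apply: cvgM; first exact: cvg_cst.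
  by apply: cvg_expr; rewrite ger0_norm// invf_lt1// ltr1n.
move=> /cvgrPdist_lt/(_ e e0)[k _ /(_ k (leqnn k))] /=.
rewrite sub0r normrN => H; exists k.
exact: le_lt_trans (ler_norm _) H.
Qed.

(** Picard iteration on the whole line at once: in the norm weighted by [E], passing from X to the
    integral of [X *m A] halves distances, so the iterates converge geometrically and no local
    solutions have to be patched. The matrix A acts on the right because vectors are rows. *)
Lemma linear_ode (n : nat) (A : R -> 'M[R]_n) (C : R) :
  continuous A -> (forall t, `|A t| <= C) ->
  exists Phi : R -> 'M[R]_n,
    Phi 0 = 1%:M /\ forall t : R, is_derive t 1 Phi (Phi t *m A t).
Proof.
move=> cA AC.
have C0 : 0 <= C by exact: le_trans (normr_ge0 _) (AC 0).
(* The first summand bounds right multiplication by A, the second bounds A itself at the start of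
   the iteration, and the third makes K positive. *)
pose K := n%:R * C + C + 1.
have K0 : 0 < K by rewrite ltr_wpDl// addr_ge0// mulr_ge0.
have KX (X : 'M[R]_n) (t : R) : `|X *m A t| <= K * `|X|.
  apply: le_trans (mulmx_norm_le _ _) _.
  rewrite mulrAC ler_wpM2r//; apply: (@le_trans _ _ (n%:R * C)).
    by rewrite ler_wpM2l.
  by rewrite /K -addrA lerDl addr_ge0.
have KA (t : R) : `|A t| <= K.
  apply: le_trans (AC t) _.
  by rewrite /K addrAC lerDr addr_ge0// mulr_ge0.
(* Continuity is a premise inside the existential, so that [choice] returns a Picard map defined on
   all functions. *)
have step (X : R -> 'M[R]_n) : exists Y : R -> 'M[R]_n, continuous X ->
    Y 0 = 1%:M /\ forall t : R, is_derive t 1 Y (X t *m A t).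
  have [cX|ncX] := pselect (continuous X); last by exists X => /ncX.
  have [|Y [Y0 HY]] := @antiderivative R n n (fun t => X t *m A t).
    by move=> t; apply: cvg_mulmx; [exact: cX|exact: cA].
  exists (fun t => 1%:M + Y t) => _; split; first by rewrite Y0 addr0.
  move=> t; have := is_deriveD (is_derive_cst (1%:M : 'M[R]_n) _ _) (HY t).
  by rewrite add0r.
have [nx Hnx] := choice step.
pose u k := iter k nx (fun=> 1%:M).
have cu k : continuous (u k).
  elim: k => [|k IH]; first by move=> t; exact: cvg_cst.
  move=> t; have [_ /(_ t)/is_derive1_differentiable] := Hnx _ IH.
  exact: differentiable_continuous.
have u0 k : u k 0 = 1%:M.
  by case: k => [//|k]; exact: (Hnx _ (cu k)).1.
have du k (t : R) : is_derive t 1 (u k.+1) (u k t *m A t).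
  exact: (Hnx _ (cu k)).2.
pose E (t : R) := expR (2 * K * `|t|).
have E1 (t : R) : 1 <= E t by rewrite -expR0 ler_expR !mulr_ge0// ltW.
have E0 (t : R) : 0 <= E t by exact: le_trans (E1 t).
have half0 k : 0 <= 2^-1 ^+ k :> R by rewrite exprn_ge0.
have uE k (t : R) : `|u k.+1 t - u k t| <= 2^-1 ^+ k * E t.
  elim: k t => [|k IH] t.
    have H (s : R) : is_derive s 1 (fun t => u 1%N t - 1%:M) (A s).
      have := is_deriveB (du 0%N s) (is_derive_cst (1%:M : 'M[R]_n) _ _).
      by rewrite mul1mx subr0.
    rewrite expr0.
    apply: le_trans (derive_exp_bound K0 ler01 _ H _ t) _.
    - by rewrite u0 subrr.
    - move=> s; rewrite mulr1. apply: le_trans (KA s) _.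
      by apply: ler_peMr; [exact: ltW|exact: E1].
    - by rewrite ler_wpM2r// mul1r invf_le1// ler1n.
  have H (s : R) : is_derive s 1 (fun t => u k.+2 t - u k.+1 t)
      ((u k.+1 s - u k s) *m A s).
    by have := is_deriveB (du k.+1 s) (du k s); rewrite mulmxBl.
  apply: le_trans (derive_exp_bound K0 (half0 k) _ H _ t) _.
  - by rewrite !u0 subrr.
  - move=> s; apply: le_trans (KX _ _) _.
    by rewrite -mulrA ler_wpM2l ?(ltW K0)//; exact: IH.
  - by rewrite exprS [2^-1 * _]mulrC.
have lim_ex (t : R) : exists l, forall k, `|l - u k t| <= 2 * E t * 2^-1 ^+ k.
  apply: (@geometric_cauchy_limit _ _ _ (fun k => u k t)) => k.
  by rewrite mulrC.
have [X HX] := choice lim_ex.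
(* Convergence is uniform within distance 1 of t, where the weight is at most [B]; three errors of
   [e / 3] then suffice. *)
have cX : continuous X.
  move=> t; apply/cvgrPdist_lt => e e0.
  pose B := expR (2 * K * (`|t| + 1)).
  have [k Hk] := @exists_half_pow_lt (2 * B) (e / 3) (divr_gt0 e0 (ltr0Sn _ _)).
  have EB (s : R) : `|t - s| < 1 -> E s <= B.
    move=> ts; rewrite ler_expR ler_wpM2l ?mulr_ge0 ?(ltW K0)//.
    have -> : s = t - (t - s) by rewrite subKr.
    by apply: le_trans (ler_normB _ _) _; rewrite lerD2l ltW.
  have near1 : \forall s \near t, `|t - s| < 1.
    by apply/nbhs_ballP; exists 1 => //= s; rewrite -ball_normE.
  have nearu : \forall s \near t, `|u k t - u k s| < e / 3.
    by have /cvgrPdist_lt := cu k t; apply; rewrite divr_gt0.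
  near=> s.
  have H (s' : R) : `|t - s'| < 1 -> `|X s' - u k s'| < e / 3.
    move=> /EB EBs; apply: le_lt_trans (HX _ _) _; apply: le_lt_trans _ Hk.
    by rewrite ler_wpM2r// ler_wpM2l.
  have -> : X t - X s = (X t - u k t) + (u k t - u k s) - (X s - u k s).
    by rewrite addrA subrK opprB addrA subrK.
  apply: le_lt_trans (ler_normB _ _) _.
  apply: le_lt_trans (lerD (ler_normD _ _) (lexx _)) _.
  have -> : e = e / 3 + e / 3 + e / 3 by field.
  rewrite !ltrD//.
  - by apply: H; rewrite subrr normr0.
  - by near: s.
  - by apply: H; near: s.
have [Y0 HY] := Hnx _ cX.
(* The limit is a fixed point: both X and [nx X] are within [2 * E t * 2^-1 ^+ k] of [u k.+1 t] for
   every k. *)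
suff XY : X = nx X.
  by exists X; split=> [|t]; [have := Y0|have := HY t]; rewrite -XY.
apply/funext => t; apply/eqP; rewrite -subr_eq0 -normr_le0.
apply/ler_addgt0Pl => e e0; rewrite addr0.
have [k Hk] := @exists_half_pow_lt (4 * E t) e e0.
rewrite -(subrKA (u k.+1 t)).
apply: le_trans (ler_normD _ _) _; apply: le_trans _ (ltW Hk).
have -> : 4 * E t * 2^-1 ^+ k = 2 * E t * 2^-1 ^+ k + 2 * E t * 2^-1 ^+ k by ring.
apply: lerD.
  apply: le_trans (HX _ _) _; rewrite ler_wpM2l ?mulr_ge0//.
  by rewrite exprS ler_piMl// invf_le1// ler1n.
rewrite distrC.
have H (s : R) : is_derive s 1 (fun t => nx X t - u k.+1 t)
      ((X s - u k s) *m A s).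
  by have := is_deriveB (HY s) (du k s); rewrite mulmxBl.
apply: le_trans (derive_exp_bound K0 (mulr_ge0 (ler0n _ 2) (half0 k)) _ H _ t) _.
- by rewrite Y0 u0 subrr.
- move=> s; apply: le_trans (KX _ _) _.
  rewrite -mulrA ler_wpM2l ?(ltW K0)//.
  by apply: le_trans (HX _ _) _; rewrite mulrAC.
- rewrite -/(E t) [leRHS]mulrAC ler_wpM2r//.
  by rewrite ler_piMr ?mulr_ge0// invf_le1// ler1n.
Unshelve. all: by end_near. Qed.

End LinearODEExistence.

(** * Immersions *)

Section FirstOrderEstimates.
Context {R : realType}.

Lemma differentiable_estimate (V W : normedModType R) (f : V -> W) a :
  differentiable f a -> forall e, 0 < e ->
  \forall y \near a, `|f y - f a - 'd f a (y - a)| <= e * `|y - a|.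
Proof.
move=> /diff_locallyP[_ fE] e e0; move/eqaddoP : fE => /(_ _ e0).
rewrite [X in _ -> X](near_shift 0) /= subr0.
apply: filterS => h /=; rewrite !fctE /= addrK.
by rewrite opprD addrA.
Qed.

Lemma is_derive1_estimate (W : normedModType R) (f : R -> W) (t : R) D :
  is_derive t 1 f D -> forall e, 0 < e ->
  \forall s \near t, `|f s - f t - (s - t) *: D| <= e * `|s - t|.
Proof.
move=> Hf e e0; have df := is_derive1_differentiable Hf.
have := differentiable_estimate df e0.
apply: filterS => s.
suff -> : 'd f t (s - t) = (s - t) *: D by [].
case: Hf => _ <-; rewrite deriveE// -linearZ /=.
by congr ('d f t _); rewrite /GRing.scale/= mulr1.
Qed.

Lemma estimate_is_derive1 (W : normedModType R) (f : R -> W) (t : R) D :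
  (forall e, 0 < e ->
    \forall s \near t, `|f s - f t - (s - t) *: D| <= e * `|s - t|) ->
  is_derive t 1 f D.
Proof.
move=> Hf.
have H : h^-1 *: (f (h *: 1 + t) - f t) @[h --> 0^'] --> D.
  apply/cvgrPdist_le => e e0; have := Hf e e0.
  rewrite (near_shift 0) /= subr0 => /nbhs_dnbhs; apply: filter_app.
  near=> h => /=.
  have h0 : h != 0 by near: h; exact: nbhs_dnbhs_neq.
  rewrite addrK => Hh.
  have -> : h *: 1 = h :> R by rewrite /GRing.scale/= mulr1.
  have -> : D - h^-1 *: (f (h + t) - f t) =
      - h^-1 *: (f (h + t) - f t - h *: D).
    by rewrite [in RHS]scalerBr !scaleNr scalerA mulVf// scale1r opprK addrC.
  by rewrite normrZ normrN normfV ler_pdivrMl ?normr_gt0// mulrC.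
split; first by apply/cvg_ex; exists D.
exact: cvg_lim H.
Unshelve. all: by end_near. Qed.

Lemma is_derive1_chain (V W : normedModType R) (f : V -> W) (u : R -> V)
    (t : R) du :
  is_derive t 1 u du -> differentiable f (u t) ->
  is_derive t 1 (fun s => f (u s)) ('d f (u t) du).
Proof.
move=> Hu df; have dut := is_derive1_differentiable Hu.
have := is_derive_diff (1 : R) (differentiable_comp dut df).
rewrite (diff_comp dut df)/=.
by case: Hu => _ <-; rewrite deriveE.
Qed.

End FirstOrderEstimates.

Section Immersions.
Context {R : realType} {m n : nat}.
Implicit Types (f : 'rV[R]_m -> 'rV[R]_n) (G : 'rV[R]_m -> 'M[R]_(m, n)).

(** After subtracting the linear map [G a], the derivative is right multiplication by [G z - G a],
    which is small near a. The mean value estimate along the segment from y to x, which stays in the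
    ball, then compares any two points. *)
Lemma strict_derivative f G (U : set 'rV[R]_m) a : open U -> U a ->
  (forall x, U x -> differentiable f x) ->
  (forall x v, U x -> 'd f x v = v *m G x) ->
  {for a, continuous G} -> forall e, 0 < e ->
  exists2 d, 0 < d & forall x y, ball a d x -> ball a d y ->
    `|f x - f y - (x - y) *m G a| <= e * `|x - y|.
Proof.
move=> oU Ua df Df cG e e0.
(* The factor m lost in [mulmx_norm_le], plus 1 to keep the denominator positive. *)
pose e' := e / (m%:R + 1).
have m1 : 0 < m%:R + 1 :> R by rewrite ltr_wpDl.
have e'0 : 0 < e' by rewrite divr_gt0.
have near1 : \forall x \near a, U x /\ `|G x - G a| <= e'.
  have H1 : \forall x \near a, U x by exact: open_nbhs_nbhs.
  have H2 : \forall x \near a, `|G a - G x| <= e'.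
    by have /cvgrPdist_le := cG; apply.
  by near=> x; split; [near: x|rewrite distrC; near: x].
have [d /= d0 Hd] := (nbhs_ballP _ _).1 near1.
exists d => // x y xd yd.
pose g (t : R) := f (y + t *: (x - y)) - t *: ((x - y) *m G a).
have seg (t : R) : 0 <= t <= 1 -> ball a d (y + t *: (x - y)).
  move=> /andP[t0 t1]; move: xd yd; rewrite -ball_normE /= => xd yd.
  have -> : a - (y + t *: (x - y)) = (1 - t) *: (a - y) + t *: (a - x).
    by apply/matrixP => i j; rewrite !mxE; ring.
  apply: le_lt_trans (ler_normD _ _) _.
  rewrite !normrZ (ger0_norm t0) ger0_norm ?subr_ge0//.
  move: t0 t1; rewrite le_eqVlt => /predU1P[<-|t0] t1.
    by rewrite subr0 mul1r mul0r addr0.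
  have -> : d = (1 - t) * d + t * d by ring.
  by rewrite ler_ltD// ?ltr_pM2l// ler_wpM2l ?subr_ge0// ltW.
have Hg (t : R) : 0 <= t <= 1 ->
    is_derive t 1 g ((x - y) *m (G (y + t *: (x - y)) - G a)).
  move=> /seg/Hd[Ut _].
  have Hl : is_derive t 1 (fun s : R => y + s *: (x - y)) (x - y).
    have := is_deriveD (is_derive_cst y _ _)
      (is_derive_scalemx (is_derive_id t (1 : R)) (is_derive_cst (x - y) _ _)).
    by rewrite add0r scaler0 addr0 scale1r.
  have H1 := is_derive1_chain Hl (df _ Ut).
  have := is_deriveB H1 (is_derive_scalemx (is_derive_id t (1 : R))
    (is_derive_cst ((x - y) *m G a) _ _)).
  by rewrite Df// scaler0 addr0 scale1r mulmxBr.
have := derive_bound_lipschitz Hg (C := e * `|x - y|).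
move=> /(_ _ 1 0); rewrite !lexx ler01 /= => H.
have := H _ isT isT; rewrite /g !scale1r !scale0r addr0 !subr0 normr1 mulr1.
rewrite [y + _]addrC subrK addrAC; apply.
move=> t /seg/Hd[_ Gt]; apply: le_trans (mulmx_norm_le _ _) _.
apply: (@le_trans _ _ (m%:R * `|x - y| * e')); first by rewrite ler_wpM2l// mulr_ge0.
rewrite mulrAC ler_wpM2r// /e' mulrCA ler_piMr ?(ltW e0)//.
by rewrite ler_pdivrMr// mul1r lerDl.
Unshelve. all: by end_near. Qed.

(** The right inverse K gives [|v| <= C * |v *m G a|]. A strict derivative with error [1 / (2 * C)]
    costs half of this bound, and the other half remains. One number d serves both as radius and as
    lower Lipschitz constant. *)
Lemma immersion_lower_bound f G (U : set 'rV[R]_m) a (K : 'M[R]_(n, m)) :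
  open U -> U a ->
  (forall x, U x -> differentiable f x) ->
  (forall x v, U x -> 'd f x v = v *m G x) ->
  {for a, continuous G} -> G a *m K = 1%:M ->
  exists2 d, 0 < d & forall x y, ball a d x -> ball a d y ->
    d * `|x - y| <= `|f x - f y|.
Proof.
move=> oU Ua df Df cG GK.
pose C := n%:R * `|K| + 1.
have C0 : 0 < C by rewrite ltr_wpDl// mulr_ge0.
have e0 : 0 < (2 * C)^-1 by rewrite invr_gt0 mulr_gt0.
have [d d0 Hd] := strict_derivative oU Ua df Df cG e0.
exists (Num.min d (2 * C)^-1); first by rewrite lt_min d0.
move=> x y xd yd.
have sub z : ball a (Num.min d (2 * C)^-1) z -> ball a d z.
  by apply: le_ball; rewrite ge_min lexx.
have {}Hd := Hd x y (sub _ xd) (sub _ yd).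
apply: (@le_trans _ _ ((2 * C)^-1 * `|x - y|)).
  by rewrite ler_wpM2r// ge_min lexx orbT.
have H1 : `|x - y| <= C * `|(x - y) *m G a|.
  rewrite -[X in `|X| <= _]mulmx1 -GK mulmxA.
  apply: le_trans (mulmx_norm_le _ _) _.
  by rewrite mulrAC ler_wpM2r// lerDl.
have H2 : `|(x - y) *m G a| <= `|f x - f y| + (2 * C)^-1 * `|x - y|.
  rewrite -[X in `|X| <= _](subKr (f x - f y)).
  exact: le_trans (ler_normB _ _) (lerD (lexx _) Hd).
have H3 : `|x - y| <= C * `|f x - f y| + `|x - y| / 2.
  apply: le_trans H1 _; apply: le_trans (ler_wpM2l (ltW C0) H2) _.
  rewrite mulrDr lerD2l mulrA invfM [C * _]mulrC mulfVK ?gt_eqF// mulrC.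
  by [].
rewrite mulrC ler_pdivrMr ?mulr_gt0//.
by rewrite [leRHS]mulrC -mulrA; lra.
Qed.

(** The lower bound turns the differentiability of [f (u s)] into a Lipschitz estimate for u at t.
    So u is continuous there, the expansion of f at [u t] applies along u, and multiplying it by K
    isolates the increment of u. The chain rule then shows that w lies in the range of the
    differential. *)
Lemma is_derive1_lift f (G : 'M[R]_(m, n)) (K : 'M[R]_(n, m))
    (u : R -> 'rV[R]_m) (t L : R) w :
  differentiable f (u t) -> (forall v, 'd f (u t) v = v *m G) ->
  G *m K = 1%:M -> 0 < L ->
  (\forall s \near t, L * `|u s - u t| <= `|f (u s) - f (u t)|) ->
  is_derive t 1 (fun s => f (u s)) w ->
  is_derive t 1 u (w *m K) /\ w *m K *m G = w.
Proof.
move=> df Df GK L0 HL Hw.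
have Hu : is_derive t 1 u (w *m K).
  apply: estimate_is_derive1 => e e0.
  (* [B] pays for multiplication by K. In [c] the fraction is the Lipschitz constant of u at t,
     multiplying the error of f, and the last 1 accounts for the error of the composite. *)
  pose B := n%:R * `|K| + 1; pose c := (`|w| + 1) / L + 1.
  have B0 : 0 < B by rewrite ltr_wpDl// mulr_ge0.
  have c0 : 0 < c by rewrite ltr_wpDl// divr_ge0 ?(ltW L0)// addr_ge0.
  pose e1 := e / (B * c).
  have e10 : 0 < e1 by rewrite divr_gt0 ?mulr_gt0.
  have N1 := is_derive1_estimate Hw ltr01.
  have N2 := is_derive1_estimate Hw e10.
  have Hlip : \forall s \near t, `|u s - u t| <= (`|w| + 1) / L * `|s - t|.
    near=> s; rewrite mulrAC ler_pdivlMr// mulrC.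
    apply: (@le_trans _ _ `|f (u s) - f (u t)|); first by near: s.
    rewrite -[f (u s) - f (u t)](subrK ((s - t) *: w)).
    apply: le_trans (ler_normD _ _) _.
    rewrite addrC mulrDl normrZ mulrC lerD2l.
    by near: s.
  have cu : u @ t --> u t.
    apply/cvgrPdist_le => e2 e20.
    have l0 : 0 < (`|w| + 1) / L by rewrite divr_gt0// ltr_wpDl.
    near=> s; rewrite distrC.
    apply: (@le_trans _ _ ((`|w| + 1) / L * `|s - t|)); first by near: s.
    rewrite mulrC -ler_pdivlMr// ltW// distrC.
    near: s; apply/nbhs_ballP; exists (e2 / ((`|w| + 1) / L)) => /=.
      by rewrite divr_gt0.
    by move=> s.
  have N3 := cu _ (differentiable_estimate df e10).
  near=> s.
  have -> : u s - u t - (s - t) *: (w *m K) =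
      ((u s - u t) *m G - (s - t) *: w) *m K.
    by rewrite mulmxBl -mulmxA GK mulmx1 scalemxAl.
  apply: le_trans (mulmx_norm_le _ _) _.
  have H3 : `|f (u s) - f (u t) - (u s - u t) *m G| <= e1 * `|u s - u t|.
    by rewrite -Df; near: s.
  have H2 : `|f (u s) - f (u t) - (s - t) *: w| <= e1 * `|s - t|.
    by near: s.
  have H1 : `|u s - u t| <= (`|w| + 1) / L * `|s - t| by near: s.
  have H : `|(u s - u t) *m G - (s - t) *: w| <= e1 * c * `|s - t|.
    have -> : (u s - u t) *m G - (s - t) *: w =
        (f (u s) - f (u t) - (s - t) *: w) -
        (f (u s) - f (u t) - (u s - u t) *m G).
      by rewrite opprB [RHS]addrC subrKA.
    apply: le_trans (ler_normB _ _) _; apply: le_trans (lerD H2 H3) _.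
    rewrite -mulrA -mulrDr ler_wpM2l ?(ltW e10)//.
    by rewrite /c mulrDl mul1r addrC lerD2r.
  apply: (@le_trans _ _ (n%:R * (e1 * c * `|s - t|) * `|K|)).
    by rewrite ler_wpM2r// ler_wpM2l.
  have -> : e * `|s - t| = B * (e1 * c * `|s - t|).
    by rewrite /e1; field; rewrite !gt_eqF.
  rewrite mulrAC; apply: ler_wpM2r; last by rewrite lerDl.
  by apply: mulr_ge0 => //; apply: mulr_ge0; exact: ltW.
split=> //.
have [_ E1] := is_derive1_chain Hu df; have [_ E2] := Hw.
by rewrite -Df -E1.
Unshelve. all: by end_near. Qed.

End Immersions.

Section CompactImmersion.
Context {R : realType} {m n : nat}.

(** Each pair of points of C has a neighbourhood with a lower Lipschitz constant: on the diagonal by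
    immersivity, off the diagonal because the two values are a positive distance apart. Compactness
    of [C * C] makes the constant uniform. *)
Lemma immersion_bilipschitz_near_compact (f : 'rV[R]_m -> 'rV[R]_n)
    (G : 'rV[R]_m -> 'M[R]_(m, n)) (U C : set 'rV[R]_m) :
  open U -> compact C -> C `<=` U ->
  (forall x, U x -> differentiable f x) ->
  (forall x v, U x -> 'd f x v = v *m G x) ->
  (forall x, C x -> {for x, continuous G}) ->
  (forall x, C x -> exists K, G x *m K = 1%:M) ->
  (forall x y, C x -> C y -> f x = f y -> x = y) ->
  exists (V : set 'rV[R]_m) (r : R),
    [/\ open V, C `<=` V, V `<=` U, 0 < r &
      forall x y, V x -> V y -> r * `|x - y| <= `|f x - f y|].
Proof.
move=> oU cC CU df Df cG GK injf.
(* A single r is both the radius of the balls and the Lipschitz constant, so one covering argument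
   with r tending to 0 from the right settles both. The conjunct [U x] will keep the union of balls
   inside U. *)
pose Pr (r : R) (p : 'rV[R]_m * 'rV[R]_m) := forall x y,
  ball p.1 r x -> ball p.2 r y -> U x /\ r * `|x - y| <= `|f x - f y|.
have cCC := compact_setX cC cC.
have tri (a x z : 'rV[R]_m) (d r : R) : r <= d / 2 -> ball a (d / 2) x ->
    ball x r z -> ball a d z.
  rewrite -ball_normE /= => rd ax xz.
  have -> : a - z = (a - x) + (x - z) by rewrite addrA subrK.
  apply: le_lt_trans (ler_normD _ _) _; rewrite (splitr d) ltrD//.
  exact: lt_le_trans xz rd.
have key p : (C `*` C) p ->
    \forall p' \near p & r \near (0 : R)^'+, Pr r p'.
  case: p => a b [/= Ca Cb].
  suff [d d_gt0 [e e_gt0 H]] : exists2 d, 0 < d & exists2 e, 0 < e &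
      forall x y r, ball a d x -> ball b d y -> 0 < r -> r <= e ->
      U x /\ r * `|x - y| <= `|f x - f y|.
    (* Half of d for moving the centres, half for the balls around them. *)
    exists (ball (a, b) (d / 2), [set r | 0 < r /\ r < Num.min e (d / 2)]).
      split=> /=; first by apply: nbhsx_ballx; rewrite divr_gt0.
      apply: filterI; first exact: nbhs_right_gt.
      by apply: nbhs_right_lt; rewrite lt_min e_gt0 divr_gt0.
    move=> [[x y] r] /= [[/= ax bY] [r_gt0]]; rewrite lt_min => /andP[re rd].
    move=> x' y' /= xx' yy'; apply: H (ltW re) => //.
    - exact: tri (ltW rd) ax xx'.
    - exact: tri (ltW rd) bY yy'.
  have [d1 /= d1_gt0 Hd1] := (nbhs_ballP _ _).1 (open_nbhs_nbhs (conj oU (CU _ Ca))).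
  have [ab|ab] := eqVneq a b.
    subst b; have [K GaK] := GK _ Ca.
    have [d d_gt0 Hd] := immersion_lower_bound oU (CU _ Ca) df Df (cG _ Ca) GaK.
    exists (Num.min d d1); first by rewrite lt_min d_gt0.
    exists d => // x y r ax ay r_gt0 rd.
    have sub z : ball a (Num.min d d1) z -> ball a d z.
      by apply: le_ball; rewrite ge_min lexx.
    split; first by apply: Hd1; apply: le_ball ax; rewrite ge_min lexx orbT.
    apply: le_trans (Hd _ _ (sub _ ax) (sub _ ay)).
    by rewrite ler_wpM2r.
  have fab : 0 < `|f a - f b|.
    by rewrite normr_gt0 subr_eq0; apply: contra_neq ab; exact: injf.
  have e4 : 0 < `|f a - f b| / 4 by rewrite divr_gt0.
  have near_f z : C z -> exists2 d, 0 < d &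
      forall x, ball z d x -> `|f z - f x| <= `|f a - f b| / 4.
    move=> Cz; have := differentiable_continuous (df _ (CU _ Cz)).
    move=> /cvgrPdist_le/(_ _ e4)/nbhs_ballP[d /= d_gt0 Hd].
    by exists d.
  have [d2 d2_gt0 Hd2] := near_f a Ca.
  have [d3 d3_gt0 Hd3] := near_f b Cb.
  pose d := Num.min d1 (Num.min d2 d3).
  have d_gt0 : 0 < d by rewrite !lt_min d1_gt0 d2_gt0.
  have L_gt0 : 0 < `|a - b| + 2 * d by rewrite ltr_wpDl// mulr_gt0.
  (* Each of the two values moves by at most a quarter of [|f a - f b|], so half of it remains; the
     denominator bounds [|x - y|]. *)
  exists d => //; exists (`|f a - f b| / 2 / (`|a - b| + 2 * d)).
    by rewrite !divr_gt0.
  move=> x y r ax bY r_gt0 re; split.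
    by apply: Hd1; apply: le_ball ax; rewrite ge_min lexx.
  have fx : `|f a - f x| <= `|f a - f b| / 4.
    by apply: Hd2; apply: le_ball ax; rewrite /d !ge_min lexx orbT.
  have fy : `|f b - f y| <= `|f a - f b| / 4.
    by apply: Hd3; apply: le_ball bY; rewrite /d !ge_min lexx !orbT.
  have H1 : `|f a - f b| / 2 <= `|f x - f y|.
    have E : f a - f b = (f x - f y) + (f a - f x) - (f b - f y).
      by apply/matrixP => i j; rewrite !mxE; ring.
    have := ler_normB ((f x - f y) + (f a - f x)) (f b - f y).
    have := ler_normD (f x - f y) (f a - f x).
    by rewrite -E; lra.
  have H2 : `|x - y| <= `|a - b| + 2 * d.
    have E : x - y = (a - b) - (a - x) + (b - y).
      by apply/matrixP => i j; rewrite !mxE; ring.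
    have := ler_normD ((a - b) - (a - x)) (b - y).
    have := ler_normB (a - b) (a - x).
    by move: ax bY; rewrite -ball_normE /= -E; lra.
  apply: le_trans _ H1.
  have -> : `|f a - f b| / 2 =
      `|f a - f b| / 2 / (`|a - b| + 2 * d) * (`|a - b| + 2 * d).
    by rewrite divfK// gt_eqF.
  by apply: ler_pM => //; exact: ltW.
have /compact_near_coveringP/(_ _ (0 : R)^'+ Pr _ key) H := cCC.
have [r [r_gt0 Hr]] : exists r : R, 0 < r /\ (C `*` C `<=` Pr r).
  have Hp : \forall r \near (0 : R)^'+, 0 < r by exact: nbhs_right_gt.
  have HpH := @filterI _ _ (@at_right_proper_filter R 0) _ _ Hp H.
  by have [r Hr] := filter_ex HpH; exists r.
exists (\bigcup_(a in C) ball a r), r; split=> //.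
- by apply: bigcup_open => a _; exact: ball_open.
- by move=> a Ca; exists a => //; exact: ballxx.
- by move=> x [a Ca ax]; have [] := Hr (a, a) (conj Ca Ca) x x ax ax.
- move=> x y [a Ca ax] [b Cb bY].
  by have [] := Hr (a, b) (conj Ca Cb) x y ax bY.
Qed.

End CompactImmersion.

(** * Ruled strips *)

Section Coordinate.
Context {R : realType} {m : nat}.
Implicit Types x v : 'rV[R]_m.+1.

Lemma is_derive_entry x v i j : is_derive x v (fun y => y i j) (v i j).
Proof. exact: (is_derive_mxP id x v v).1 (is_derive_id x v) i j. Qed.

Lemma diff_entry x v i j : 'd (fun y : 'rV[R]_m.+1 => y i j) x v = v i j.
Proof.
rewrite -deriveE; first by case: (is_derive_entry x v i j).
exact: differentiable_coord.
Qed.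

Lemma is_derive_comp_entry (W : normedModType R) (f : R -> W) x v df :
  is_derive (x 0 0) 1 f df ->
  is_derive x v (fun y => f (y 0 0)) (v 0 0 *: df).
Proof.
move=> Hf; have df0 := is_derive1_differentiable Hf.
have dc : differentiable (fun y : 'rV[R]_m.+1 => y 0 0) x.
  exact: differentiable_coord.
have := is_derive_diff v (differentiable_comp dc df0).
rewrite diff_comp//= diff_entry.
suff -> : 'd f (x 0 0) (v 0 0) = v 0 0 *: df by [].
case: Hf => _ <-; rewrite deriveE// -linearZ /=.
by congr ('d f _ _); rewrite /GRing.scale/= mulr1.
Qed.

Lemma Ck_comp_entry (W : normedModType R) k (I : set R) (f : R -> W) :
  open I -> Ck k I f ->
  Ck k [set x : 'rV[R]_m.+1 | I (x 0 0)] (fun y => f (y 0 0)).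
Proof.
move=> oI; apply: (Ck_comp_affine (c := fun v => v 0 0)) => //.
- by apply: open_comp oI => x _; exact: coord_continuous.
- by move=> x; exact: differentiable_coord.
- by move=> x v; exact: diff_entry.
Qed.

Lemma Ck_id (V : normedModType R) k (U : set V) : open U -> Ck k U id.
Proof.
have di (x : V) : differentiable (@id V) x by have [] := is_diff_id x.
move=> oU; case: k => [|k]; first by split.
split=> // v.
by apply: Ck_eq oU _ (Ck_cst k U v) => x _; rewrite derive_id.
Qed.

End Coordinate.

Section Lines.
Context {R : realType} {V : normedModType R}.

Lemma is_derive_line (a v : V) (t : R) :
  is_derive t 1 (fun s : R => a + s *: v) v.
Proof.
apply: estimate_is_derive1 => e e_gt0; near=> s.
by rewrite opprD addrACA subrr add0r -scalerBl subrr normr0 mulr_ge0// ltW.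
Unshelve. all: by end_near. Qed.

Lemma Ck_comp_line (W : normedModType R) k (U : set V) (f : V -> W) (a v : V) :
  open U -> Ck k U f ->
  Ck k [set s : R | U (a + s *: v)] (fun s => f (a + s *: v)).
Proof.
move=> oU; have dl (s : R) := is_derive1_differentiable (is_derive_line a v s).
apply: (Ck_comp_affine (p := fun s : R => a + s *: v) (c := fun s => s *: v)).
- apply: open_comp oU => s _; exact: differentiable_continuous.
- by [].
- exact: dl.
- move=> s u; have [_ E] := is_derive_line a v s.
  rewrite -[in RHS]E deriveE// -linearZ /=; congr ('d _ _ _).
  by rewrite /GRing.scale/= mulr1.
Qed.

Lemma open_line_preimage (U : set V) (a v : V) : open U ->
  open [set s : R | U (a + s *: v)].
Proof.
move=> oU; apply: open_comp oU => s _.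
exact/differentiable_continuous/is_derive1_differentiable/is_derive_line.
Qed.

End Lines.

Section DotProduct.
Context {R : realType} {N : nat}.
Implicit Types u v w : 'rV[R]_N.

Lemma dotE u v : dot u v = (u *m v^T) 0 0.
Proof. by rewrite mxE; apply: eq_bigr => i _; rewrite mxE. Qed.

Lemma dotBl u v w : dot (u - v) w = dot u w - dot v w.
Proof. by rewrite !dotE mulmxBl !mxE. Qed.

Lemma dot_eq0 u : dot u u = 0 -> u = 0.
Proof.
move=> /eqP; rewrite psumr_eq0 => [/allP u0|i _]; last exact: sqr_ge0.
apply/matrixP => i j; rewrite ord1 mxE; apply/eqP.
by have := u0 j (mem_index_enum _); rewrite /= mulf_eq0 orbb.
Qed.

End DotProduct.

Lemma rowspan_dim (R : realType) (p N : nat) (B : 'M[R]_(p, N))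
    (K : 'M[R]_(N, p)) : B *m K = 1%:M ->
  is_subspace_of_dim p [set w : 'rV[R]_N | exists k : 'rV[R]_p, w = k *m B].
Proof.
move=> BK; pose f : 'Hom('rV[R]_p, 'rV[R]_N) := linfun (mulmxr B).
have fE k : f k = k *m B by rewrite lfunE.
exists (limg f).
  rewrite limg_dim_eq; first by rewrite dimvf /dim /= mul1n.
  apply/eqP; rewrite -subv0; apply/subvP => k /memv_capP[_].
  rewrite memv_ker fE memv0 => /eqP kB.
  by rewrite -[k]mulmx1 -BK mulmxA kB mul0mx.
apply/seteqP; split=> w /=.
  by move=> [k ->]; rewrite -fE memv_img ?memvf.
by move=> /memv_imgP[k _ ->]; exists k.
Qed.

(** The Sherman-Morrison formula; a is the determinant of the update. *)
Lemma rank_one_update_mulV (R : fieldType) (n : nat) (q : 'cV[R]_n)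
    (e : 'rV[R]_n) (a : R) : a != 0 -> e *m q = (a - 1)%:M ->
  (1%:M + q *m e) *m (1%:M - a^-1 *: (q *m e)) = 1%:M.
Proof.
move=> a0 eq; rewrite mulmxBr mulmx1 -scalemxAr mulmxDl mul1mx.
rewrite mulmxA -[q *m e *m q]mulmxA eq mul_mx_scalar -scalemxAl.
rewrite scalerDr scalerA -scalerDl -addrA -[X in _ + (X - _)]scale1r -scalerBl.
suff -> : 1 - (a^-1 + a^-1 * (a - 1)) = 0 by rewrite scale0r addr0.
by field.
Qed.

Section RuledStrip.
Context {R : realType} {m N : nat}.
Context (I : set R) (A Phi : R -> 'M[R]_N) (P : 'M[R]_(m.+1, N)).
Context (rho : R -> 'cV[R]_m.+1) (eta delta : R -> 'rV[R]_N).

Let e0 : 'rV[R]_m.+1 := delta_mx 0 0.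

(* The strip is ruled by the affine m-planes through delta t spanned by the rows
   of [strip_rulings t]; its tangent space along such a plane is spanned by the
   rows of [strip_frame t].  As frame' = rho *m eta and axis' = rho_0 *: eta, the
   slope rho / rho_0 is the multiple of the axis to subtract from the frame in
   order that the derivative of the rulings is tangent to the strip (a multiple
   of the axis); row 0 of [strip_rulings t] vanishes. *)
Definition strip_frame t : 'M[R]_(m.+1, N) := P *m Phi t.
Definition strip_axis t : 'rV[R]_N := e0 *m strip_frame t.
Definition strip_slope t : 'cV[R]_m.+1 := (rho t 0 0)^-1 *: rho t.
Definition strip_rulings t : 'M[R]_(m.+1, N) :=
  strip_frame t - strip_slope t *m strip_axis t.
Definition strip (x : 'rV[R]_m.+1) : 'rV[R]_N :=
  delta (x 0 0) + x *m strip_rulings (x 0 0).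
(** The partial derivative of the strip in the direction of the first coordinate is this multiple of
    the axis, so the strip degenerates exactly where it vanishes. *)
Definition strip_width (x : 'rV[R]_m.+1) : R :=
  1 - (x *m derive1 strip_slope (x 0 0)) 0 0.
Definition strip_jacobian (x : 'rV[R]_m.+1) : 'M[R]_(m.+1, N) :=
  strip_width x *: (e0^T *m strip_axis (x 0 0)) + strip_rulings (x 0 0).

Let F := strip_frame.
Let X := strip_axis.
Let nu := strip_slope.
Let Z := strip_rulings.
Let phi := strip.
Let h := strip_width.
Let G := strip_jacobian.
Let c := derive1 nu.

Context (oI : open I)
  (PhiO : forall t, I t -> Phi t *m (Phi t)^T = 1%:M)
  (dPhi : forall t : R, I t -> is_derive t 1 Phi (Phi t *m A t))
  (FA : forall t, I t -> strip_frame t *m A t = rho t *m eta t)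
  (Feta : forall t, I t -> strip_frame t *m (eta t)^T = 0)
  (eta_neq0 : forall t, I t -> eta t != 0)
  (rho_neq0 : forall t, I t -> rho t 0 0 != 0)
  (ddelta : forall t : R, I t -> is_derive t 1 delta (strip_axis t))
  (sPhi : forall k, Ck k I Phi) (srho : forall k, Ck k I rho).

Lemma e0_unit : e0 *m e0^T = 1%:M.
Proof.
by rewrite trmx_delta mul_delta_mx; apply/matrixP => i j; rewrite !mxE !ord1.
Qed.

Lemma e0_slope t : I t -> e0 *m nu t = 1%:M.
Proof.
move=> It; apply/matrixP => i j; rewrite !ord1 -rowE !mxE eqxx mulVf//.
exact: rho_neq0.
Qed.

Lemma smooth_slope k : Ck k I nu.
Proof.
apply: Ck_scalemx => //; apply: Ck_inv => //.
exact: (Ck_mxP _ _ oI).1 (srho k) 0 0.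
Qed.

Lemma is_derive_slope (t : R) : I t -> is_derive t 1 nu (c t).
Proof. exact: Ck_is_derive (smooth_slope 0). Qed.

Lemma smooth_dslope k : Ck k I c.
Proof. exact/Ck_derive1/smooth_slope. Qed.

(** The first entry of the slope is constantly 1 on the open set I. This is what makes the width
    equal to 1 along the axis. *)
Lemma e0_dslope t : I t -> e0 *m c t = 0.
Proof.
move=> It.
have H1 := is_derive_mulmx (is_derive_cst e0 t (1 : R)) (is_derive_slope It).
have H2 : is_derive t 1 (fun s => e0 *m nu s) 0.
  apply: near_eq_is_derive (is_derive_cst (1%:M : 'M[R]_1) _ _).
  by apply: near_open_eq It _ => // s Is; rewrite e0_slope.
case: H2 => _ <-; case: H1 => _ ->.
by rewrite mul0mx add0r.
Qed.

Lemma is_derive_frame (t : R) : I t -> is_derive t 1 F (rho t *m eta t).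
Proof.
move=> It.
have := is_derive_mulmx (is_derive_cst P t (1 : R)) (dPhi It).
by rewrite mul0mx add0r mulmxA FA.
Qed.

Lemma is_derive_axis (t : R) : I t -> is_derive t 1 X (rho t 0 0 *: eta t).
Proof.
move=> It.
have := is_derive_mulmx (is_derive_cst e0 t (1 : R)) (is_derive_frame It).
rewrite mul0mx add0r mulmxA.
suff -> : e0 *m rho t = (rho t 0 0)%:M by rewrite mul_scalar_mx.
by rewrite -rowE; apply/matrixP => i j; rewrite !ord1 !mxE eqxx.
Qed.

Lemma is_derive_rulings (t : R) : I t -> is_derive t 1 Z (- (c t *m X t)).
Proof.
move=> It.
have := is_deriveB (is_derive_frame It)
  (is_derive_mulmx (is_derive_slope It) (is_derive_axis It)).
rewrite -scalemxAr scalemxAl scalerA divff ?rho_neq0// scale1r.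
by rewrite opprD addrCA subrr addr0.
Qed.

Lemma smooth_frame k : Ck k I F.
Proof. by apply: Ck_mulmx => //; exact: Ck_cst. Qed.

Lemma smooth_axis k : Ck k I X.
Proof. by apply: Ck_mulmx => //; [exact: Ck_cst|exact: smooth_frame]. Qed.

Lemma smooth_rulings k : Ck k I Z.
Proof.
have H : Ck k I (fun t => F t + (-1) *: (nu t *m X t)).
  apply: Ck_add => //; first exact: smooth_frame.
  apply: Ck_scale => //; apply: Ck_mulmx => //; [exact: smooth_slope|].
  exact: smooth_axis.
by apply: Ck_eq oI _ H => t _; rewrite scaleN1r.
Qed.

Lemma smooth_delta k : Ck k I delta.
Proof.
case: k => [|k].
  by split=> // t It; exact: is_derive1_differentiable (ddelta It).
by apply: CkS_is_derive ddelta _ => //; exact: smooth_axis.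
Qed.

Let U := [set x : 'rV[R]_m.+1 | I (x 0 0)].

Lemma open_strip_domain : open U.
Proof.
by apply: open_comp oI => x _; exact: coord_continuous.
Qed.

Lemma strip_smooth k : Ck k U phi.
Proof.
apply: Ck_add; first exact: open_strip_domain.
  exact: Ck_comp_entry oI (smooth_delta k).
apply: Ck_mulmx; first exact: open_strip_domain.
  exact: Ck_id open_strip_domain.
exact: Ck_comp_entry oI (smooth_rulings k).
Qed.

Lemma smooth_width k : Ck k U h.
Proof.
have oU := open_strip_domain.
have H : Ck k U (fun x => 1%:M - x *m c (x 0 0)).
  have H1 : Ck k U (fun x => x *m c (x 0 0)).
    by apply: Ck_mulmx => //; [exact: Ck_id|
       exact: Ck_comp_entry oI (smooth_dslope k)].
  have H2 := Ck_add oU (Ck_cst k U (1%:M : 'M[R]_1)) (Ck_scale (-1) oU H1).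
  by apply: Ck_eq oU _ H2 => x _; rewrite scaleN1r.
have {}H := (Ck_mxP _ _ oU).1 H 0 0.
by apply: Ck_eq oU _ H => x _; rewrite /h /strip_width !mxE.
Qed.

Lemma smooth_jacobian k : Ck k U G.
Proof.
have oU := open_strip_domain.
apply: Ck_add => //; last exact: Ck_comp_entry oI (smooth_rulings k).
apply: Ck_scalemx => //; first exact: smooth_width.
apply: Ck_mulmx => //; first exact: Ck_cst.
exact: Ck_comp_entry oI (smooth_axis k).
Qed.

Lemma entry_scale (v : 'rV[R]_m.+1) : v *m e0^T = (v 0 0)%:M.
Proof.
by rewrite trmx_delta -colE; apply/matrixP => i j; rewrite !mxE !ord1.
Qed.

Lemma diff_strip x v : U x -> 'd phi x v = v *m G x.
Proof.
move=> Ux; have It : I (x 0 0) by [].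
have dphi : differentiable phi x by exact: Ck_differentiable (strip_smooth 0) Ux.
have H1 := is_derive_comp_entry v (ddelta It).
have H2 := is_derive_comp_entry v (is_derive_rulings It).
have [_] := is_deriveD H1 (is_derive_mulmx (is_derive_id x v) H2).
rewrite -deriveE// => ->.
have xc : x *m c (x 0 0) = ((x *m c (x 0 0)) 0 0)%:M.
  by apply/matrixP => i j; rewrite !ord1 [RHS]mxE eqxx.
have -> : x *m (v 0 0 *: - (c (x 0 0) *m X (x 0 0))) =
    - (v 0 0 * (x *m c (x 0 0)) 0 0) *: X (x 0 0).
  by rewrite scalerN mulmxN -scalemxAr mulmxA xc mul_scalar_mx scalerA scaleNr
     [in RHS]mxE eqxx mulr1n.
rewrite /G /strip_jacobian [RHS]mulmxDr -[in RHS]scalemxAr [in RHS]mulmxA.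
rewrite entry_scale mul_scalar_mx.
rewrite scalerA addrCA addrC -scalerDl; congr (_ *: _ + _).
by rewrite /strip_width mulrBl mul1r [in RHS]mulrC.
Qed.

Let q x : 'cV[R]_m.+1 := h x *: e0^T - nu (x 0 0).

(** Axis and rulings are both combinations of the frame. The transition matrix is a rank-one update
    of determinant [h x], so wherever the width is nonzero the Jacobian and the frame have the same
    row space, which depends on the first coordinate only. *)
Lemma jacobian_frame x : G x = (1%:M + q x *m e0) *m F (x 0 0).
Proof.
rewrite [RHS]mulmxDl mul1mx -[in RHS]mulmxA [X in _ + X]mulmxBl.
by rewrite -[in RHS]scalemxAl addrCA.
Qed.

Lemma e0_q x : U x -> e0 *m q x = (h x - 1)%:M.
Proof.
move=> Ux; rewrite mulmxBr -scalemxAr e0_unit e0_slope//.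
by rewrite scalemx1 -raddfB.
Qed.

Definition strip_mixing_inv x : 'M[R]_m.+1 := 1%:M - (h x)^-1 *: (q x *m e0).

Lemma mixing_mulV (x : 'rV[R]_m.+1) : U x -> h x != 0 ->
  (1%:M + q x *m e0) *m strip_mixing_inv x = 1%:M.
Proof.
by move=> Ux hx; apply: rank_one_update_mulV => //; exact: e0_q.
Qed.

Context (K : 'M[R]_(N, m.+1)) (PK : P *m K = 1%:M).

Lemma frame_mulV t : I t -> F t *m ((Phi t)^T *m K) = 1%:M.
Proof. by move=> It; rewrite mulmxA -[F t *m _]mulmxA PhiO// mulmx1. Qed.

Definition strip_jacobian_inv (x : 'rV[R]_m.+1) : 'M[R]_(N, m.+1) :=
  (Phi (x 0 0))^T *m K *m strip_mixing_inv x.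

Lemma jacobian_mulV (x : 'rV[R]_m.+1) : U x -> h x != 0 ->
  G x *m strip_jacobian_inv x = 1%:M.
Proof.
move=> Ux hx; rewrite jacobian_frame mulmxA -[_ *m F _ *m _]mulmxA frame_mulV//.
by rewrite mulmx1 mixing_mulV.
Qed.

Lemma jacobian_range (x : 'rV[R]_m.+1) (w : 'rV[R]_N) : U x -> h x != 0 ->
  (exists v : 'rV_m.+1, w = v *m G x) <->
  (exists k : 'rV_m.+1, w = k *m F (x 0 0)).
Proof.
move=> Ux hx; split=> -[v ->].
  by exists (v *m (1%:M + q x *m e0)); rewrite jacobian_frame mulmxA.
exists (v *m strip_mixing_inv x); rewrite jacobian_frame -mulmxA.
have /mulmx1C E := mixing_mulV Ux hx.
by rewrite [_ *m (_ *m F _)]mulmxA E mul1mx.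
Qed.


Lemma entry_axis (t : R) : (t *: e0) 0 0 = t.
Proof. by rewrite !mxE eqxx mulr1. Qed.

Lemma width_axis (t : R) : I t -> h (t *: e0) = 1.
Proof.
move=> It; rewrite /h /strip_width entry_axis -scalemxAl e0_dslope//.
by rewrite scaler0 mxE subr0.
Qed.

Lemma strip_on_axis (t : R) : I t -> phi (t *: e0) = delta t.
Proof.
move=> It; rewrite /phi /strip entry_axis -scalemxAl /strip_rulings mulmxBr.
rewrite [X in _ - X]mulmxA e0_slope// mul1mx.
by rewrite -/(strip_axis t) subrr scaler0 addr0.
Qed.

Context (Askew : forall t, I t -> (A t)^T = - A t).

Context (P_axis_unit : (e0 *m P) *m (e0 *m P)^T = 1%:M).

(** * The strip near its axis: submanifold, tangent spaces, second fundamental form *)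

Section Tube.
Context (V : set 'rV[R]_m.+1) (r : R) (oV : open V)
  (VU : forall x, V x -> I (x 0 0)) (r_gt0 : 0 < r)
  (bilip : forall x y, V x -> V y -> r * `|x - y| <= `|strip x - strip y|).

Let M := phi @` V.

Lemma Ck_strip k : Ck k V phi.
Proof. exact: Ck_subset VU (strip_smooth k). Qed.

Lemma differentiable_strip x : V x -> differentiable phi x.
Proof. exact: Ck_differentiable (Ck_strip 0). Qed.

(** If the width vanished, [e0] would lie in the kernel of the differential, and a small step along
    [e0] would move the image by less than the lower Lipschitz bound allows. *)
Lemma width_neq0 x : V x -> h x != 0.
Proof.
move=> Vx; have Ix := VU Vx; have Ux : U x by []; apply/eqP => hx0.
have near1 := differentiable_estimate (differentiable_strip Vx)
  (divr_gt0 r_gt0 (ltr0Sn R 1)).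
have near2 : \forall y \near x, V y by exact: open_nbhs_nbhs.
have [d /= d0 Hd] := (nbhs_ballP _ _).1 (filterI near1 near2).
pose y := x + (d / 2) *: e0.
have d20 : 0 < d / 2 by rewrite divr_gt0.
have yx : y - x = (d / 2) *: e0 by rewrite /y addrC addKr.
have ne0 : `|e0| = 1 :> R.
  apply/eqP; rewrite eq_le; apply/andP; split.
    by apply: mx_norm_le => // i j; rewrite /e0 mxE normr_nat lern1 leq_b1.
  by have := mx_norm_entry e0 0 0; rewrite /e0 mxE !eqxx normr1.
have nyx : `|y - x| = d / 2 by rewrite yx normrZ ne0 mulr1 gtr0_norm.
have yd : ball x d y.
  by rewrite -ball_normE /= distrC nyx ltr_pdivrMr// ltr_pMr// ltr1n.
have [/= H1 Vy] := Hd y yd.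
have e0G : e0 *m G x = 0.
  rewrite /G /strip_jacobian -/h hx0 scale0r add0r /strip_rulings.
  by rewrite mulmxBr [X in _ - X]mulmxA e0_slope // mul1mx subrr.
have dyx : 'd phi x (y - x) = 0.
  by rewrite diff_strip // yx -scalemxAl e0G scaler0.
have := bilip Vy Vx; move: H1; rewrite -/phi dyx subr0 nyx => H1 H2.
have := le_trans H2 H1; have := mulr_gt0 r_gt0 d20.
rewrite [r / 2 * _]mulrAC; lra.
Qed.

Lemma strip_inj x y : V x -> V y -> phi x = phi y -> x = y.
Proof.
move=> Vx Vy E; apply/eqP; rewrite -subr_eq0 -normr_le0.
have := bilip Vx Vy; rewrite -/phi E subrr normr0.
by rewrite pmulr_rle0.
Qed.

Definition strip_chart (p : 'rV[R]_N) : 'rV[R]_m.+1 :=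
  get [set x | V x /\ phi x = p].

Let g := strip_chart.

Lemma strip_chartP p : M p -> V (g p) /\ phi (g p) = p.
Proof.
case=> x Vx xp; apply: (@getPex _ [set x | V x /\ phi x = p]).
by exists x.
Qed.

Lemma strip_chartK x : V x -> g (phi x) = x.
Proof.
move=> Vx; have [Vg E] := strip_chartP (ex_intro2 _ _ x Vx erefl).
exact: strip_inj.
Qed.

Lemma strip_embedding : topological_embedding V phi.
Proof.
split.
  apply: continuous_in_subspaceT => x /set_mem Vx.
  exact: differentiable_continuous (differentiable_strip Vx).
exists g; first exact: strip_chartK.
apply/subspace_continuousP => p Mp.
have [Vg Eg] := strip_chartP Mp.
apply/cvgrPdist_le => e e_gt0; rewrite near_withinE.
(* The inverse is Lipschitz with constant [1 / r]. *)
apply/nbhs_ballP; exists (r * e) => /=; first exact: mulr_gt0.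
move=> s; rewrite -ball_normE /= => Hs Ms.
have [Vs Es] := strip_chartP Ms.
have := bilip Vg Vs; rewrite -/phi Eg Es => H.
by rewrite -(ler_pM2l r_gt0); apply: le_trans H (ltW Hs).
Qed.

Lemma strip_parametrization : local_parametrization M setT V phi.
Proof.
split; split=> //.
- exact: openT.
- by rewrite setIT.
- exact: strip_embedding.
- by apply/smooth_onP; exists V; split=> // k; exact: Ck_strip.
- move=> x Vx v w; have Ux : U x by exact: VU.
  rewrite !diff_strip // => /(congr1 (mulmx^~ (strip_jacobian_inv x))).
  by rewrite -!mulmxA jacobian_mulV ?mulmx1 // width_neq0.
Qed.

Lemma strip_embedded : embedded_submanifold m.+1 M.
Proof.
by move=> p Mp; exists setT, V, phi; split=> //; exact: strip_parametrization.
Qed.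

(* Curves in the strip that are differentiable in the ambient space are
   differentiable in the coordinates, since the chart is Lipschitz. *)
Lemma strip_lift (u : R -> 'rV[R]_N) (t : R) x w :
  (\forall s \near t, M (u s)) -> V x -> phi x = u t ->
  is_derive t 1 u w ->
  is_derive t 1 (fun s => g (u s)) (w *m strip_jacobian_inv x) /\
  w *m strip_jacobian_inv x *m G x = w.
Proof.
move=> Mu Vx xu Hu; have Ux : U x by exact: VU.
have gx : g (u t) = x by rewrite -xu strip_chartK.
have phig : \forall s \near t, phi (g (u s)) = u s.
  by apply: filterS Mu => s /strip_chartP[].
have H : is_derive t 1 (fun s => phi (g (u s))) w.
  by apply: near_eq_is_derive Hu; apply: filterS phig => s.
apply: (is_derive1_lift (f := phi) _ _ _ r_gt0 _ H).
- by rewrite gx; exact: differentiable_strip.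
- by move=> v; rewrite gx diff_strip.
- by rewrite jacobian_mulV // width_neq0.
- apply: filterS Mu => s Ms; rewrite gx.
  by apply: bilip => //; case: (strip_chartP Ms).
Qed.

(** A curve in M lifts to a differentiable coordinate curve, so its velocity is in the range of the
    Jacobian; conversely, coordinate lines realize that whole range. *)
Lemma strip_tangent_space x : V x ->
  tangent_space M (phi x) =
  [set w | exists k : 'rV[R]_m.+1, w = k *m F (x 0 0)].
Proof.
move=> Vx; have Ux : U x by exact: VU.
apply/seteqP; split=> w /=.
  move=> [J [u [[oJ J0 su uM] [u0 uw]]]].
  apply/(jacobian_range _ Ux (width_neq0 Vx)).
  have Hu : is_derive (0 : R) 1 u w.
    move/smooth_onP : su => [J' [_ JJ' Cu]].
    by rewrite -uw; exact: Ck_is_derive (Cu 0%N) (JJ' _ J0).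
  have Mu : \forall s \near 0, M (u s).
    have : \forall s \near 0, J s by exact: open_nbhs_nbhs.
    by apply: filterS => s Js; apply: uM; exists s.
  have [_ <-] := strip_lift Mu Vx (esym u0) Hu.
  by exists (w *m strip_jacobian_inv x).
move=> /(jacobian_range _ Ux (width_neq0 Vx))[v ->].
exists [set s : R | V (x + s *: v)], (fun s => phi (x + s *: v)).
split; split.
- exact: open_line_preimage.
- by rewrite /= scale0r addr0.
- apply/smooth_onP; exists [set s : R | V (x + s *: v)]; split=> //.
    exact: open_line_preimage.
  by move=> k; apply: Ck_comp_line => //; exact: Ck_strip.
- by move=> _ [s Vs <-]; exists (x + s *: v).
- by rewrite scale0r addr0.
- have dphi : differentiable phi (x + 0 *: v).
    by rewrite scale0r addr0; exact: differentiable_strip.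
  have [_] := is_derive1_chain (is_derive_line x v 0) dphi.
  rewrite /velocity derive1E => ->.
  by rewrite scale0r addr0 diff_strip.
Qed.

Lemma eta_orthogonal x w (l : 'rV[R]_1) : V x ->
  tangent_space M (phi x) w -> dot (l *m eta (x 0 0)) w = 0.
Proof.
move=> Vx; rewrite strip_tangent_space// => -[k ->].
have E : eta (x 0 0) *m (F (x 0 0))^T = 0.
  by apply: trmx_inj; rewrite trmx_mul trmxK Feta ?trmx0//; exact: VU.
by rewrite dotE trmx_mul mulmxA -[l *m _ *m _]mulmxA E mulmx0 mul0mx mxE.
Qed.

(* Extending y along the strip with constant coefficients with respect to the
   frame gives a tangent field with derivative in the direction of eta. *)
Lemma strip_sff_exists x (v k : 'rV[R]_m.+1) : V x ->
  is_second_fundamental_form m.+1 M (phi x) (v *m G x) (k *m F (x 0 0))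
    (v 0 0 *: (k *m rho (x 0 0) *m eta (x 0 0))).
Proof.
move=> Vx; have Ux : U x by exact: VU.
pose Y q := k *m F ((g q) 0 0).
have CY j : Ck j U (fun y => k *m F (y 0 0)).
  apply: Ck_mulmx; [exact: open_strip_domain|exact: Ck_cst|].
  exact: Ck_comp_entry oI (smooth_frame j).
have CYphi j : Ck j V (Y \o phi).
  apply: Ck_eq oV _ (Ck_subset VU (CY j)) => y Vy.
  by rewrite /Y /= strip_chartK.
have DY : 'd (Y \o phi) x v = v 0 0 *: (k *m rho (x 0 0) *m eta (x 0 0)).
  rewrite -deriveE; last exact: Ck_differentiable (CYphi 0%N) Vx.
  have := is_derive_mulmx (is_derive_cst k _ _)
    (is_derive_comp_entry v (is_derive_frame Ux)).
  move=> [_]; rewrite mul0mx add0r -scalemxAr mulmxA => <-.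
  apply: near_eq_derive; have : \forall y \near x, V y by exact: open_nbhs_nbhs.
  by apply: filterS => y Vy; rewrite /Y /= strip_chartK.
exists setT, V, phi, Y, x, v; split; split=> //.
- exact: strip_parametrization.
- by rewrite diff_strip.
- by apply/smooth_onP; exists V; split.
- move=> p [/strip_chartP[Vg Eg] _].
  rewrite -[in tangent_space _ _]Eg strip_tangent_space//.
  by exists k.
- by rewrite /Y strip_chartK.
- rewrite DY subrr strip_tangent_space//; exists 0.
  by rewrite mul0mx.
- by move=> w Tw; rewrite scalemxAl; exact: eta_orthogonal Tw.
Qed.

(** The chart and the tangent field in the definition are arbitrary. Along a curve, tangency of the
    field Y means that Y multiplied by the transpose of Phi stays in the row space of P, a condition
    independent of time. Differentiating it determines the derivative of Y modulo the tangent space,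
    and two normal vectors congruent modulo the tangent space coincide. *)
Lemma strip_sff_unique x (v k : 'rV[R]_m.+1) w : V x ->
  is_second_fundamental_form m.+1 M (phi x) (v *m G x) (k *m F (x 0 0)) w ->
  w = v 0 0 *: (k *m rho (x 0 0) *m eta (x 0 0)).
Proof.
move=> Vx; have Ux : U x by exact: VU.
move=> [U' [V' [phi' [Y [a [v' [[[par1 par2] V'a phi'a dphi'] [sY TY Yp Tw nw]]]]]]]].
have [_ oV' phi'V' _] := par1; have [sphi' _] := par2.
pose l s := a + s *: v'.
have l0 : l 0 = a by rewrite /l scale0r addr0.
have Hl : is_derive (0 : R) 1 l v' by exact: is_derive_line.
have V'l : \forall s \near (0 : R), V' (l s).
  have oJ : open [set s : R | V' (l s)] by exact: open_line_preimage.
  by apply: open_nbhs_nbhs; split=> //=; rewrite l0.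
have MU : \forall s \near (0 : R), (M `&` U') (phi' (l s)).
  by apply: filterS V'l => s V's; rewrite -phi'V'; exists (l s).
have smooth_diff (W : normedModType R) (f : 'rV[R]_m.+1 -> W) :
    smooth_on V' f -> differentiable f (l 0).
  move/smooth_onP => [B [_ V'B Cf]]; rewrite l0.
  exact: Ck_differentiable (Cf 0%N) (V'B _ V'a).
have Hu : is_derive (0 : R) 1 (fun s => phi' (l s)) (v *m G x).
  have := is_derive1_chain Hl (smooth_diff _ _ sphi').
  by rewrite l0 dphi'.
pose D := 'd (Y \o phi') a v'.
have HY : is_derive (0 : R) 1 (fun s => Y (phi' (l s))) D.
  by have := is_derive1_chain Hl (smooth_diff _ _ sY); rewrite l0.
have Mu : \forall s \near (0 : R), M (phi' (l s)).
  by apply: filterS MU => s [].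
have xu : phi x = phi' (l 0) by rewrite l0.
(* The test curve comes from the foreign chart; it is re-read in the coordinates of the strip, where
   its velocity is v. *)
have [Hb _] := strip_lift Mu Vx xu Hu.
pose b s := g (phi' (l s)).
have {}Hb : is_derive (0 : R) 1 b v.
  move: Hb; rewrite -mulmxA jacobian_mulV ?mulmx1//.
  exact: width_neq0.
have b0 : b 0 = x by rewrite /b -xu strip_chartK.
pose b1 s := b s 0 0.
have Hb1 : is_derive (0 : R) 1 b1 (v 0 0) by exact: (is_derive_mxP b 0 1 v).1.
have It : I (b1 0) by rewrite /b1 b0.
have HPhi : is_derive (0 : R) 1 (fun s => Phi (b1 s))
    (v 0 0 *: (Phi (x 0 0) *m A (x 0 0))).
  have dP := is_derive1_differentiable (dPhi It).
  have := is_derive1_chain Hb1 dP.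
  suff -> : 'd Phi (b1 0) (v 0 0) = v 0 0 *: (Phi (x 0 0) *m A (x 0 0)) by [].
  have [_ E] := dPhi Ux; rewrite /b1 b0 -[in RHS]E deriveE; last first.
    by have := dP; rewrite /b1 b0.
  by rewrite -linearZ /=; congr ('d _ _ _); rewrite /GRing.scale/= mulr1.
(* Right multiplication by [Q] is a projection whose kernel is exactly the row space of P, which
   turns tangency into a linear equation. *)
pose Q : 'M[R]_N := 1%:M - K *m P.
have PQ : P *m Q = 0 by rewrite mulmxBr mulmx1 mulmxA PK mul1mx subrr.
have H1 := is_derive_mulmx (is_derive_mulmx HY (is_derive_trmx HPhi))
  (is_derive_cst Q (0 : R) (1 : R)).
have H2 : is_derive (0 : R) 1
    (fun s => Y (phi' (l s)) *m (Phi (b1 s))^T *m Q) 0.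
  apply: near_eq_is_derive (is_derive_cst (0 : 'rV[R]_N) _ _).
  apply: filterS MU => s Ms; have [/strip_chartP[Vg Eg] _] := Ms.
  have := TY _ Ms; rewrite -{1}Eg strip_tangent_space// => -[j ->].
  rewrite /F /strip_frame -/(b s) -/(b1 s).
  rewrite -!mulmxA [Phi _ *m _]mulmxA PhiO; last exact: VU.
  by rewrite mul1mx PQ mulmx0.
have E1 : k *m F (x 0 0) *m (v 0 0 *: (Phi (x 0 0) *m A (x 0 0)))^T =
    - (v 0 0 *: (k *m rho (x 0 0) *m eta (x 0 0)) *m (Phi (x 0 0))^T).
  rewrite linearZ /= trmx_mul Askew// mulNmx scalerN mulmxN -scalemxAr.
  rewrite -scalemxAl; congr (- (_ *: _)).
  by rewrite mulmxA -[k *m F _ *m _]mulmxA FA// !mulmxA.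
have E : (D - v 0 0 *: (k *m rho (x 0 0) *m eta (x 0 0))) *m
    (Phi (x 0 0))^T *m Q = 0.
  case: H2 => _ <-; case: H1 => _ ->; rewrite mulmx0 addr0; congr (_ *m _).
  by rewrite l0 phi'a Yp /b1 b0 mulmxBl E1.
pose w0 := v 0 0 *: (k *m rho (x 0 0) *m eta (x 0 0)).
have Tw0 : tangent_space M (phi x) (D - w0).
  rewrite strip_tangent_space//; exists ((D - w0) *m (Phi (x 0 0))^T *m K).
  have PhiO' : (Phi (x 0 0))^T *m Phi (x 0 0) = 1%:M.
    by apply: mulmx1C; exact: PhiO.
  have : (D - w0) *m (Phi (x 0 0))^T *m Q *m Phi (x 0 0) = 0.
    by rewrite E mul0mx.
  rewrite mulmxBr mulmx1 mulmxBl -[_ *m _ *m Phi _]mulmxA PhiO' mulmx1.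
  by move/subr0_eq => {1}->; rewrite /F /strip_frame !mulmxA.
(* The difference of the two candidates is both tangent and normal. *)
apply/subr0_eq/dot_eq0.
have Tww : tangent_space M (phi x) (w - w0).
  move: Tw Tw0; rewrite strip_tangent_space// => -[k1 Ek1] [k2 Ek2].
  exists (k2 - k1); rewrite mulmxBl -Ek1 -Ek2.
  by rewrite opprB [RHS]addrC subrKA.
rewrite dotBl nw// sub0r.
have := eta_orthogonal (v 0 0 *: (k *m rho (x 0 0))) Vx Tww.
by rewrite -scalemxAl -/w0 => ->; rewrite oppr0.
Qed.

Lemma strip_sff x (v k : 'rV[R]_m.+1) : V x ->
  second_fundamental_form m.+1 M (phi x) (v *m G x) (k *m F (x 0 0)) =
  v 0 0 *: (k *m rho (x 0 0) *m eta (x 0 0)).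
Proof.
move=> Vx; apply: strip_sff_unique => //.
exact: getPex (ex_intro _ _ (strip_sff_exists v k Vx)).
Qed.

Lemma strip_nullity x : V x ->
  nullity_space m.+1 M (phi x) =
  [set w | exists k : 'rV[R]_m, w = k *m (row' 0 1%:M *m G x)].
Proof.
move=> Vx; have Ux : U x by exact: VU.
have Tx := strip_tangent_space Vx; have hx := width_neq0 Vx.
apply/seteqP; split=> w /=.
  rewrite /nullity_space /= Tx /= => -[/(jacobian_range _ Ux hx)[v ->] null].
  (* Testing against the axis suffices: its coefficient is the nonzero first entry of rho, so the
     first coordinate of v must vanish. *)
  have := null (e0 *m F (x 0 0)) (ex_intro _ e0 erefl).
  rewrite strip_sff// => /eqP; rewrite scaler_eq0 => /orP[/eqP v0|].
    exists (col' 0 v); rewrite mulmxA; congr (_ *m _).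
    apply/matrixP => i j; rewrite -[LHS](congr1 (fun B : 'rV_m.+1 => B i j) (mulmx1 v)).
    rewrite ord1 mxE big_ord_recl v0 mul0r add0r mxE.
    by apply: eq_bigr => l _; rewrite !mxE.
  have -> : e0 *m rho (x 0 0) = (rho (x 0 0) 0 0)%:M.
    by rewrite -rowE; apply/matrixP => i j; rewrite !ord1 !mxE eqxx.
  rewrite mul_scalar_mx scaler_eq0.
  by rewrite (negbTE (rho_neq0 Ux)) (negbTE (eta_neq0 Ux)).
move=> [k ->]; rewrite mulmxA /nullity_space /= Tx; split.
  apply/(jacobian_range _ Ux hx).
  by exists (k *m row' 0 1%:M).
move=> y /= [l ->]; rewrite strip_sff//.
suff -> : (k *m row' 0 1%:M : 'rV[R]_m.+1) 0 0 = 0 by rewrite scale0r.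
by rewrite mxE big1// => i _; rewrite !mxE mulr0.
Qed.

Lemma strip_rank_one : rank_one_submanifold m.+1 M.
Proof.
split; first exact: strip_embedded.
move=> _ [x Vx <-]; rewrite strip_nullity//.
apply: (@rowspan_dim _ _ _ _ (strip_jacobian_inv x *m (row' 0 1%:M)^T)).
rewrite mulmxA -[_ *m G x *m _]mulmxA jacobian_mulV//; last first.
- exact: width_neq0.
- exact: VU.
rewrite mulmx1; apply/matrixP => i j; rewrite mxE (bigD1 (lift 0 i))//=.
rewrite !mxE eqxx mul1r big1 ?addr0 => [|l li].
  by rewrite (inj_eq lift_inj) eq_sym.
by rewrite !mxE eq_sym (negbTE li) mul0r.
Qed.

(** * The induced metric along the axis and the geodesic equation *)

Let gram := e0 *m P *m P^T.

(** The flow is orthogonal, so the inner products of the axis with the frame keep their initial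
    values. *)
Lemma axis_frame t : I t -> X t *m (F t)^T = gram.
Proof.
move=> It; rewrite trmx_mul /X /strip_axis /strip_frame !mulmxA.
by rewrite -[_ *m Phi t *m _]mulmxA PhiO// mulmx1.
Qed.

Lemma axis_unit t : I t -> X t *m (X t)^T = 1%:M.
Proof.
move=> It; rewrite [(X t)^T]trmx_mul mulmxA axis_frame//.
by rewrite -P_axis_unit trmx_mul !mulmxA.
Qed.

Lemma gram0 : gram 0 0 = 1.
Proof.
have : (gram *m e0^T) 0 0 = 1.
  by rewrite /gram -!mulmxA -trmx_mul mulmxA P_axis_unit mxE.
by rewrite entry_scale mxE.
Qed.

Lemma slope0 t : I t -> nu t 0 0 = 1.
Proof.
move=> It; have := e0_slope It => /(congr1 (fun B : 'M[R]_1 => B 0 0)).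
by rewrite -rowE !mxE.
Qed.

Lemma dslope0 t : I t -> c t 0 0 = 0.
Proof.
move=> It; have := e0_dslope It => /(congr1 (fun B : 'M[R]_1 => B 0 0)).
by rewrite -rowE !mxE.
Qed.

(** Row 0 is singled out because the Christoffel symbols with lower indices 0 0 differentiate only
    entries of this row. The first partial derivative is [h] times the unit axis, and the axis has
    inner product [gram 0 l - nu l 0] with ruling l. *)
Lemma metric_axis_row y l : V y ->
  induced_metric phi y 0 l =
  h y * h y * (l == 0)%:R + h y * (gram 0 l - nu (y 0 0) l 0).
Proof.
move=> Vy; have Uy : U y by exact: VU.
have De i : 'D_(delta_mx 0 i) phi y = delta_mx 0 i *m G y.
  by rewrite deriveE ?diff_strip//; exact: differentiable_strip.
rewrite mxE !De dotE trmx_mul mulmxA.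
have -> : delta_mx 0 0 *m G y = h y *: X (y 0 0).
  rewrite -/e0 /G /strip_jacobian mulmxDr -scalemxAr mulmxA e0_unit mul1mx.
  rewrite /strip_rulings mulmxBr [X in _ + (_ - X)]mulmxA e0_slope// mul1mx.
  by rewrite subrr addr0.
rewrite -!scalemxAl.
have -> : X (y 0 0) *m (G y)^T = h y *: e0 + (gram - (nu (y 0 0))^T).
  rewrite /G /strip_jacobian linearD linearZ /= mulmxDr -scalemxAr.
  rewrite trmx_mul trmxK mulmxA axis_unit// mul1mx.
  rewrite /strip_rulings linearB /= mulmxBr axis_frame// trmx_mul mulmxA.
  by rewrite axis_unit// mul1mx.
rewrite trmx_delta -colE.
by rewrite !mxE /= mulrDr mulrA.
Qed.

Lemma is_derive_width_axis (t : R) v : V (t *: e0) ->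
  is_derive (t *: e0) v h (- (v *m c t) 0 0).
Proof.
move=> Vt; have It := VU Vt.
have t0 := entry_axis t.
rewrite t0 in It.
have Hc : is_derive t 1 c (derive1 c t) by exact: Ck_is_derive (smooth_dslope 0) It.
(* The second derivative of the slope enters multiplied by the base point [t *: e0], hence drops out
   on the axis. *)
have e0c : e0 *m derive1 c t = 0.
  have H1 := is_derive_mulmx (is_derive_cst e0 t (1 : R)) Hc.
  have H2 : is_derive t 1 (fun s => e0 *m c s) 0.
    apply: near_eq_is_derive (is_derive_cst (0 : 'M[R]_1) _ _).
    by apply: near_open_eq It _ => // s Is; rewrite e0_dslope.
  case: H2 => _ <-; case: H1 => _ ->.
  by rewrite mul0mx add0r.
have Hcx : is_derive (t *: e0) v (fun y => c (y 0 0)) (v 0 0 *: derive1 c t).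
  by apply: is_derive_comp_entry; rewrite t0.
have H := is_derive_mulmx (is_derive_id (t *: e0) v) Hcx.
have H0 := (is_derive_mxP _ _ _ _).1 H 0 0.
have := is_deriveB (is_derive_cst (1 : R) (t *: e0) v) H0.
rewrite sub0r t0 -scalemxAl -scalemxAr e0c !scaler0 addr0.
by [].
Qed.

Lemma is_derive_metric_axis (t : R) v l : V (t *: e0) ->
  is_derive (t *: e0) v (fun y => induced_metric phi y 0 l)
    (- (v *m c t) 0 0 * ((l == 0)%:R *+ 2 + gram 0 l - nu t l 0)
     - v 0 0 * c t l 0).
Proof.
move=> Vt; have t0 := entry_axis t.
have It : I t by rewrite -t0; exact: VU.
have Hh := is_derive_width_axis v Vt.
have Hnu : is_derive (t *: e0) v (fun y => nu (y 0 0) l 0) (v 0 0 * c t l 0).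
  have Hl := (is_derive_mxP _ _ _ _).1 (is_derive_slope It) l 0.
  by apply: (is_derive_comp_entry (f := fun s => nu s l 0)); rewrite t0.
have H1 := is_deriveM (is_deriveM Hh Hh) (is_derive_cst ((l == 0)%:R : R) (t *: e0) v).
have H2 := is_deriveM Hh (is_deriveB (is_derive_cst (gram 0 l) (t *: e0) v) Hnu).
have H3 := is_deriveD H1 H2.
have := near_eq_is_derive _ H3; move=> /(_ (fun y => induced_metric phi y 0 l)).
rewrite !fctE t0 (width_axis It) /GRing.scale/=.
set D := (X in is_derive _ _ _ X); set D' := (X in _ -> is_derive _ _ _ X).
suff -> : D' = D.
  apply.
  have : \forall y \near (t *: e0), V y by exact: open_nbhs_nbhs.
  by apply: filterS => y Vy; rewrite metric_axis_row.
by rewrite /D /D'; ring.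
Qed.

(** On the axis the partial derivatives are [d_0 g_0l = - c_l] and [d_l g_00 = - 2 c_l], so the
    bracket [2 d_0 g_0l - d_l g_00] vanishes for each l. *)
Lemma christoffel_axis (t : R) k : V (t *: e0) ->
  christoffel phi k 0 0 (t *: e0) = 0.
Proof.
move=> Vt; have t0 := entry_axis t.
have It : I t by rewrite -t0; exact: VU.
rewrite /christoffel big1 ?mulr0// => l _.
have [_ E1] := is_derive_metric_axis e0 l Vt.
have [_ E2] := is_derive_metric_axis (delta_mx 0 l) 0 Vt.
rewrite -/e0 E1 E2 e0_dslope// gram0 slope0// -rowE !mxE !eqxx.
by rewrite dslope0//; ring.
Qed.

Lemma axis_geodesic (t : R) : V (t *: e0) ->
  geodesic_equation phi (fun s : R => s *: e0) t.
Proof.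
move=> Vt k.
have vE : velocity (fun s : R => s *: e0) = fun=> e0.
  apply/funext => s; rewrite /velocity derive1E.
  have [_] := is_derive_line 0 e0 s.
  by under eq_fun do rewrite add0r.
have -> : acceleration (fun s : R => s *: e0) t = 0.
  rewrite -[LHS]/(derive1 (velocity (fun s : R => s *: e0)) t) vE.
  exact: derive1_cst.
rewrite mxE add0r big1// => i _; rewrite big1// => j _; rewrite vE !mxE /=.
have [->|_] := eqVneq i 0; last by rewrite mulr0 mul0r.
have [->|_] := eqVneq j 0; last by rewrite mulr0.
by rewrite christoffel_axis// !mul0r.
Qed.

Lemma strip_geodesic (S : set R) (gamma : R -> 'rV[R]_N) :
  (forall t, S t -> V (t *: e0)) -> (forall t, S t -> gamma t = delta t) ->
  geodesic_of m.+1 M S gamma.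
Proof.
move=> SV Sg t0 St0.
have oJ : open [set t : R | V (t *: e0)].
  have := open_line_preimage (a := 0) (v := e0) oV.
  by under eq_set do rewrite add0r.
exists setT, V, phi, [set t : R | V (t *: e0)], (fun s : R => s *: e0).
split; first split.
- exact: strip_parametrization.
- exact: oJ.
- exact: SV.
- apply/smooth_onP; exists setT; split=> // [|k]; first exact: openT.
  apply: Ck_eq openT _ (Ck_comp_line 0 e0 openT (Ck_id k openT)) => s _.
  by rewrite add0r.
- by move=> _ [t Vt <-].
move=> t St Vt; split; last exact: axis_geodesic.
have It : I t by rewrite -[t]entry_axis; exact/VU/SV.
by rewrite Sg// strip_on_axis.
Qed.

End Tube.

(** On the compact segment of the axis over [[0, alpha]] the strip map is the injective curve itself
    and has width 1, so the bi-Lipschitz neighbourhood of that segment supplies the domain V assumed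
    so far. *)
Theorem exists_rank_one_strip (alpha : R) (gamma : R -> 'rV[R]_N) :
  0 <= alpha -> (forall t, 0 <= t <= alpha -> I t) ->
  (forall t, 0 <= t <= alpha -> gamma t = delta t) ->
  {in [pred t | 0 <= t <= alpha] &, injective gamma} ->
  exists M : set 'rV[R]_N,
    [/\ rank_one_submanifold m.+1 M, gamma @` `[0, alpha] `<=` M,
        tangent_space M (gamma 0) =
          [set w | exists k : 'rV[R]_m.+1, w = k *m strip_frame 0] &
        geodesic_of m.+1 M `[0, alpha] gamma].
Proof.
move=> alpha_ge0 SI Sg injg.
have SE t : `[0, alpha]%classic t -> 0 <= t <= alpha by rewrite /= in_itv.
pose C := (fun t : R => t *: e0) @` `[0, alpha].
have cC : compact C.
  apply: continuous_compact; last exact: segment_compact.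
  by apply: continuous_subspaceT => t; exact: scalel_continuous.
have CU : C `<=` U by move=> _ [t /SE St <-]; rewrite /U /= entry_axis; exact: SI.
have [|||||V [r [oV CV VU r_gt0 bilip]]] := immersion_bilipschitz_near_compact
    (f := phi) (G := G) open_strip_domain cC CU.
- by move=> x; exact: Ck_differentiable (strip_smooth 0).
- exact: diff_strip.
- move=> x /CU Ux; apply: differentiable_continuous.
  exact: Ck_differentiable (smooth_jacobian 0) Ux.
- move=> x Cx; exists (strip_jacobian_inv x); apply: jacobian_mulV.
    exact: CU.
  by case: Cx => t /SE St <-; rewrite width_axis ?oner_neq0//; exact: SI.
- move=> _ _ [s /SE Ss <-] [t /SE St <-].
  have Is := SI _ Ss; have It := SI _ St.
  by rewrite !strip_on_axis// -!Sg// => /injg ->.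
have SV t : 0 <= t <= alpha -> V (t *: e0).
  by move=> St; apply: CV; exists t => //=; rewrite in_itv.
have S0 : (0 : R) <= (0 : R) <= alpha by apply/andP; split.
exists (phi @` V); split.
- exact: strip_rank_one oV VU r_gt0 bilip.
- move=> _ [t /SE St <-]; exists (t *: e0); first exact: SV.
  by have It := SI _ St; rewrite strip_on_axis// Sg.
- have I0 := SI _ S0; rewrite Sg// -strip_on_axis//.
  rewrite (strip_tangent_space oV VU r_gt0 bilip).
    by rewrite entry_axis.
  exact: SV.
- apply: (strip_geodesic oV VU r_gt0 bilip) => t /SE St; [exact: SV|exact: Sg].
Qed.

End RuledStrip.

(** * Passing from a closed interval to a neighbourhood; orthogonal flows *)

Section RealCurves.
Context {R : realType}.

Lemma derive0_constantT (m n : nat) (f : R -> 'M[R]_(m, n)) :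
  (forall t : R, is_derive t 1 f 0) -> forall x y, f x = f y.
Proof.
move=> Hf x y.
have H (a b t : R) (_ : a <= t <= b) := Hf t.
have Ix : Num.min x y <= x <= Num.max x y by rewrite ge_min lexx le_max lexx.
have Iy : Num.min x y <= y <= Num.max x y.
  by rewrite ge_min lexx le_max lexx !orbT.
exact: derive0_constant (H _ _) _ _ Ix Iy.
Qed.

(** At an end point f is known to be constant on one side only, but an existing two-sided derivative
    is determined by the difference quotients from that side. *)
Lemma is_derive_constant_on (W : normedModType R) (f : R -> W) (alpha t : R) D w :
  0 < alpha -> 0 <= t <= alpha -> (forall s, 0 <= s <= alpha -> f s = w) ->
  is_derive t 1 f D -> D = 0.
Proof.
move=> alpha_gt0 tI fw Hf; apply/eqP; rewrite -normr_le0.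
apply/ler_addgt0Pl => e e_gt0; rewrite addr0.
have [d /= d_gt0 Hd] := (nbhs_ballP _ _).1 (is_derive1_estimate Hf e_gt0).
have [s [sI st std]] : exists s, [/\ 0 <= s <= alpha, s != t & `|t - s| < d].
  (* A step of this length towards the farther end point stays in the interval and in the ball. *)
  pose b := Num.min (d / 2) (alpha / 2).
  have b_gt0 : 0 < b by rewrite lt_min !divr_gt0.
  have bd : b < d by rewrite gt_min; apply/orP; left; lra.
  have ba : b <= alpha / 2 by rewrite ge_min lexx orbT.
  have [ta|ta] := leP t (alpha / 2).
    exists (t + b); split; first by lra.
      by apply/eqP; lra.
    by rewrite opprD addrA subrr sub0r normrN gtr0_norm.
  exists (t - b); split; first by lra.
    by apply/eqP; lra.
  by rewrite subKr gtr0_norm.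
have /= := Hd s std.
rewrite !fw// subrr sub0r normrN normrZ mulrC ler_pM2r//.
by rewrite normr_gt0 subr_eq0.
Qed.

(** Time is clamped to [[a, b]]. The last clause lets pointwise identities of f, such as skewness,
    pass to the extension. *)
Lemma continuous_extension (m n : nat) (f : R -> 'M[R]_(m, n)) (a b : R) :
  a <= b -> (forall t, a <= t <= b -> {for t, continuous f}) ->
  exists F : R -> 'M[R]_(m, n), exists C,
    [/\ continuous F, (forall t, `|F t| <= C),
      (forall t, a <= t <= b -> F t = f t) &
      forall t, exists2 s, a <= s <= b & F t = f s].
Proof.
move=> ab cf; pose cl t := Num.max a (Num.min t b).
have clI t : a <= cl t <= b.
  by rewrite le_max lexx /= ge_max ab ge_min lexx orbT.
have cl_id t : a <= t <= b -> cl t = t.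
  by move=> /andP[a_t tb]; rewrite /cl (min_idPl tb) (max_idPr a_t).
have clL s t : `|cl s - cl t| <= `|s - t|.
  have := ler_norm (s - t); have := ler_norm (- (s - t)); rewrite normrN.
  rewrite ler_norml /cl; case: (leP s b) => ?; case: (leP t b) => ?;
  case: (leP a s) => ?; case: (leP a t) => ?; case: (leP a b) => ?; lra.
have ccl : continuous cl.
  move=> t; apply/cvgrPdist_le => e e_gt0; apply/nbhs_ballP; exists e => //= s.
  by move=> /ltW; exact: le_trans (clL t s).
have cF : continuous (f \o cl).
  by move=> t; apply: continuous_comp; [exact: ccl|exact/cf].
have [|c cI Hc] := @EVT_max R (fun t => `|f (cl t)|) a b ab.
  apply: continuous_subspaceT => t.
  by apply: (continuous_comp (cF t)); exact: norm_continuous.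
exists (f \o cl), `|f (cl c)|; split=> //= t.
- by rewrite -{1}[cl t]cl_id//; apply: Hc; rewrite in_itv /= clI.
- by move=> tI; rewrite cl_id.
- by exists (cl t).
Qed.

Lemma open_segment_margin (O : set R) (alpha : R) :
  0 <= alpha -> open O -> (forall t, 0 <= t <= alpha -> O t) ->
  exists2 r : R, 0 < r & forall t, - r <= t <= alpha + r -> O t.
Proof.
move=> alpha_ge0 oO OI.
have H0 : O 0 by apply: OI; lra.
have Ha : O alpha by apply: OI; lra.
have [d /= d_gt0 Hd] := (nbhs_ballP _ _).1 (open_nbhs_nbhs (conj oO H0)).
have [e /= e_gt0 He] := (nbhs_ballP _ _).1 (open_nbhs_nbhs (conj oO Ha)).
pose r := Num.min (d / 2) (e / 2).
have r_gt0 : 0 < r by rewrite lt_min !divr_gt0.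
have rd : r < d by rewrite gt_min; apply/orP; left; lra.
have re : r < e by rewrite gt_min; apply/orP; right; lra.
exists r => // t tI; have [t0|t0] := ltP t 0.
  apply: Hd; rewrite -ball_normE /= sub0r normrN ltr0_norm//; lra.
have [ta|ta] := leP t alpha; first by apply: OI; lra.
by apply: He; rewrite -ball_normE /= distrC gtr0_norm; lra.
Qed.

(** Skewness makes the derivative [Phi (A + A^T) Phi^T] of [Phi Phi^T] vanish. *)
Lemma skew_flow (n : nat) (A : R -> 'M[R]_n) (C : R) :
  continuous A -> (forall t, `|A t| <= C) -> (forall t, (A t)^T = - A t) ->
  exists Phi : R -> 'M[R]_n, [/\ Phi 0 = 1%:M,
    (forall t : R, is_derive t 1 Phi (Phi t *m A t)) &
    forall t, Phi t *m (Phi t)^T = 1%:M].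
Proof.
move=> cA AC skA; have [Phi [Phi0 dPhi]] := linear_ode cA AC.
exists Phi; split=> // t.
have H (s : R) : is_derive s 1 (fun s => Phi s *m (Phi s)^T) 0.
  have := is_derive_mulmx (dPhi s) (is_derive_trmx (dPhi s)).
  by rewrite trmx_mul skA mulNmx mulmxN mulmxA subrr.
rewrite (derive0_constantT H t 0) Phi0.
by rewrite trmx1 mulmx1.
Qed.

Lemma Ck_flow (n : nat) (O : set R) (A Phi : R -> 'M[R]_n) : open O ->
  (forall k, Ck k O A) ->
  (forall t : R, O t -> is_derive t 1 Phi (Phi t *m A t)) ->
  forall k, Ck k O Phi.
Proof.
move=> oO CA dPhi; elim=> [|k IH].
  by split=> // t Ot; exact: is_derive1_differentiable (dPhi t Ot).
by apply: CkS_is_derive dPhi _ => //; exact: Ck_mulmx.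
Qed.

End RealCurves.

Lemma exists_basis_with_first_row (R : realType) (m N : nat)
    (D : {vspace 'rV[R]_N}) (v : 'rV[R]_N) :
  \dim D = m.+1 -> v \in D -> v != 0 ->
  exists P : 'M[R]_(m.+1, N), exists K : 'M[R]_(N, m.+1),
    [/\ delta_mx 0 0 *m P = v, P *m K = 1%:M &
      [set w | w \in D] = [set w | exists k : 'rV[R]_m.+1, w = k *m P]].
Proof.
move=> dimD vD v0.
(* A complement of the line through v inside D; its basis, preceded by v, is a basis of D. *)
pose W := (D :\: <[v]>)%VS.
have vD' : (<[v]> <= D)%VS by rewrite -memvE.
have dimW : \dim W = m.
  have := dimv_cap_compl D <[v]>; rewrite dimD -/W.
  by rewrite (capv_idPr vD') dim_vline v0 => -[].
have sizeX : size (v :: vbasis W) == m.+1 by rewrite size_tuple dimW.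
pose X : m.+1.-tuple 'rV[R]_N := Tuple sizeX.
have spanX : (<<X>> = D)%VS.
  rewrite span_cons (span_basis (vbasisP W)) addvC.
  by have := addv_diff D <[v]>; rewrite (addv_idPl vD').
have freeX : free X by rewrite /free spanX dimD size_tuple.
pose P : 'M[R]_(m.+1, N) := \matrix_i X`_i.
have PE (k : 'rV[R]_m.+1) : k *m P = \sum_(i < m.+1) k 0 i *: X`_i.
  by rewrite mulmx_sum_row; apply: eq_bigr => i _; rewrite rowK.
have Pfree : row_free P.
  apply: inj_row_free => k; rewrite PE => Hk.
  apply/rowP => i; rewrite mxE.
  by move/freeP : freeX => /(_ (fun i => k 0 i) Hk i).
exists P, (pinvmx P); split.
- by rewrite -rowE rowK.
- by rewrite mulmxVp.
- apply/seteqP; split=> w /=.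
    rewrite -spanX => /coord_span ->.
    exists (\row_i coord X i w).
    by rewrite PE; apply: eq_bigr => i _; rewrite mxE.
  move=> [k ->]; rewrite PE -spanX; apply: memv_suml => i _.
  by apply/memvZ/memv_span/mem_nth; rewrite size_tuple.
Qed.

(** * The frame along the curve *)

Section NormalConnection.
Context {R : realType} {N : nat} (O : set R) (eta : R -> 'rV[R]_N).
Context (oO : open O) (seta : forall k, Ck k O eta)
  (eta_neq0 : forall t, O t -> eta t != 0).

Definition sqnorm t : R := (eta t *m (eta t)^T) 0 0.

(* A frame F with F' = F * normal_connection stays orthogonal to eta if it starts
   so, and then it turns in the direction of eta only. *)
Definition normal_connection t : 'M[R]_N :=
  (sqnorm t)^-1 *: ((eta t)^T *m derive1 eta t - (derive1 eta t)^T *m eta t).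

Let A := normal_connection.

Lemma sqnorm_neq0 t : O t -> sqnorm t != 0.
Proof. by move=> /eta_neq0; apply: contra_neq; rewrite /sqnorm -dotE => /dot_eq0. Qed.

Lemma normal_connection_skew t : (A t)^T = - A t.
Proof.
rewrite /A /normal_connection linearZ linearB /= !trmx_mul !trmxK.
by rewrite -opprB scalerN.
Qed.

Lemma normal_connection_smooth k : Ck k O A.
Proof.
have Cd : Ck k O (derive1 eta) by exact: Ck_derive1.
have Ce : Ck k O (fun t => (eta t)^T) by exact: Ck_trmx.
apply: Ck_scalemx => //.
  apply: Ck_inv => //; first exact: sqnorm_neq0.
  have := Ck_mulmx oO (seta k) Ce => /(Ck_mxP _ _ oO); exact.
have C1 := Ck_mulmx oO Ce Cd.
have C2 := Ck_mulmx oO (Ck_trmx oO Cd) (seta k).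
apply: Ck_eq oO _ (Ck_add oO C1 (Ck_scale (-1) oO C2)) => t _.
by rewrite scaleN1r.
Qed.

Lemma mulmx_connection (p : nat) (F : 'M[R]_(p, N)) t :
  F *m (eta t)^T = 0 ->
  F *m A t = - (sqnorm t)^-1 *: (F *m (derive1 eta t)^T) *m eta t.
Proof.
move=> F0; rewrite -scalemxAr mulmxBr !mulmxA F0 mul0mx sub0r.
by rewrite scalerN -scaleNr scalemxAl.
Qed.

Lemma is_derive_sqnorm (t : R) : O t ->
  is_derive t 1 sqnorm ((derive1 eta t *m (eta t)^T) 0 0 *+ 2).
Proof.
move=> Ot; have He := Ck_is_derive (seta 0) Ot.
have := (is_derive_mxP _ _ _ _).1 (is_derive_mulmx He (is_derive_trmx He)) 0 0.
rewrite mxE mulr2n.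
suff -> : (eta t *m (derive1 eta t)^T) 0 0 = (derive1 eta t *m (eta t)^T) 0 0 by [].
have -> : eta t *m (derive1 eta t)^T = (derive1 eta t *m (eta t)^T)^T.
  by rewrite trmx_mul trmxK.
by rewrite mxE.
Qed.

Lemma is_derive_sqnormV (t : R) : O t ->
  is_derive t 1 (fun s => (sqnorm s)^-1)
    (- (sqnorm t) ^- 2 * ((derive1 eta t *m (eta t)^T) 0 0 *+ 2)).
Proof.
move=> Ot; have [d E] := is_derive_sqnorm Ot.
by split; [exact: derivableV (sqnorm_neq0 Ot) d|rewrite deriveV ?sqnorm_neq0 ?E].
Qed.

(** The product f of F with the transpose of eta solves the scalar equation [f' = (d / |eta|^2) f],
    where d is the inner product of eta' and eta, so [f / |eta|] is constant. *)
Lemma frame_stays_normal (p : nat) (F : R -> 'M[R]_(p, N)) (a b t0 : R) :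
  (forall t, a <= t <= b -> O t) ->
  (forall t, a <= t <= b -> is_derive t 1 F (F t *m A t)) ->
  a <= t0 <= b -> F t0 *m (eta t0)^T = 0 ->
  forall t, a <= t <= b -> F t *m (eta t)^T = 0.
Proof.
move=> abO HF t0I F0 t tI.
pose f s := F s *m (eta s)^T.
pose d s := (derive1 eta s *m (eta s)^T) 0 0.
have Hf s : a <= s <= b -> is_derive s 1 f (((sqnorm s)^-1 * d s) *: f s).
  move=> sI; have Os := abO s sI; have He := Ck_is_derive (seta 0) Os.
  have := is_derive_mulmx (HF s sI) (is_derive_trmx He).
  rewrite -[F s *m A s]scalemxAr -scalemxAl mulmxBr mulmxBl !mulmxA.
  rewrite -/(f s) -[f s *m _ *m _]mulmxA [derive1 eta s *m _]mx11_scalar.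
  rewrite -[_ *m eta s *m _]mulmxA [eta s *m _]mx11_scalar -/(sqnorm s) -/(d s).
  rewrite !mul_mx_scalar scalerBr !scalerA mulVf ?sqnorm_neq0// scale1r.
  by rewrite subrK.
(* The square of the conserved quantity, which avoids differentiating a square root; its diagonal
   entries are squared norms of the rows. *)
pose w s := (sqnorm s)^-1 *: (f s *m (f s)^T).
have Hw s : a <= s <= b -> is_derive s 1 w 0.
  move=> sI; have Os := abO s sI; have s0 := sqnorm_neq0 Os.
  have := is_derive_scalemx (is_derive_sqnormV Os)
    (is_derive_mulmx (Hf s sI) (is_derive_trmx (Hf s sI))).
  rewrite -/(d s) linearZ /= -scalemxAl -scalemxAr -scalerDl scalerA -scalerDl.
  suff -> : - sqnorm s ^- 2 * (d s *+ 2) +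
      (sqnorm s)^-1 * ((sqnorm s)^-1 * d s + (sqnorm s)^-1 * d s) = 0.
    by rewrite scale0r.
  by field.
have : w t = 0.
  by rewrite (derive0_constant Hw tI t0I) /w /f F0 mul0mx scaler0.
move=> /eqP; rewrite scaler_eq0 invr_eq0 (negbTE (sqnorm_neq0 (abO t tI))) /=.
rewrite -/(f t) => /eqP ff; apply/row_matrixP => i; rewrite row0.
apply: dot_eq0; rewrite dotE.
by rewrite rowE trmx_mul mulmxA -[_ *m _ *m (f t)^T]mulmxA ff mulmx0 mul0mx mxE.
Qed.

End NormalConnection.

(** * Assembling the strip along the given curve *)

Lemma open_neq0 (R : realType) (V W : normedModType R) (U : set V) (f : V -> W) :
  open U -> (forall x, U x -> differentiable f x) ->
  open [set x | U x /\ f x != 0].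
Proof.
move=> oU df; rewrite openE => x [Ux fx0].
apply: filterI; first exact: open_nbhs_nbhs.
have fx_gt0 : 0 < `|f x| by rewrite normr_gt0.
have /cvgrPdist_lt/(_ _ fx_gt0) := differentiable_continuous (df x Ux).
by apply: filterS => y; apply: contraTneq => ->; rewrite subr0 ltxx.
Qed.

Lemma enorm0 (R : realType) (N : nat) : enorm (0 : 'rV[R]_N) = 0.
Proof. by rewrite /enorm dotE mul0mx mxE sqrtr0. Qed.

Lemma mulmx_unit (R : realType) (N : nat) (u : 'rV[R]_N) :
  enorm u = 1 -> u *m u^T = 1%:M.
Proof.
move=> u1; rewrite [LHS]mx11_scalar -dotE -[dot u u]sqr_sqrtr.
  by rewrite -/(enorm u) u1 expr1n.
by apply: sumr_ge0 => i _; exact: sqr_ge0.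
Qed.

(** For an orthogonal flow this expresses that a solution of [v' = v A] is its initial value
    transported by the flow; it identifies the velocity of the curve with the axis. *)
Lemma is_derive_flow_invariant (R : realType) (N : nat)
    (v : R -> 'rV[R]_N) (Phi : R -> 'M[R]_N) (A : 'M[R]_N) (t : R) :
  A^T = - A -> is_derive t 1 v (v t *m A) -> is_derive t 1 Phi (Phi t *m A) ->
  is_derive t 1 (fun s => v s *m (Phi s)^T) 0.
Proof.
move=> skA dv dPhi; have := is_derive_mulmx dv (is_derive_trmx dPhi).
by rewrite trmx_mul skA mulNmx mulmxN mulmxA subrr.
Qed.

Theorem theorem8p2 (R : realType) (m n : nat) (alpha : R)
    (gamma : R -> 'rV[R]_(m + n)) (D0 : {vspace 'rV[R]_(m + n)})
    (hm : (2 <= m)%N) (hn : (1 <= n)%N) (halpha : 0 < alpha)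
    (gamma_smooth : smooth_on `[0, alpha] gamma)
    (gamma_unit : unit_speed_on `[0, alpha] gamma)
    (gamma_emb : embedded_curve_on `[0, alpha] gamma)
    (gamma_curv : forall t, 0 <= t <= alpha -> curvature gamma t != 0)
    (dimD0 : \dim D0 = m)
    (D0_tangent : velocity gamma 0 \in D0)
    (D0_normal : orth_compl [set v | v \in D0] (acceleration gamma 0))
    (gamma_full : full (gamma @` `[0, alpha])) :
  exists M : set 'rV[R]_(m + n),
    [/\ rank_one_submanifold m M,
        full M,
        gamma @` `[0, alpha] `<=` M,
        tangent_space M (gamma 0) = [set v | v \in D0] &
        geodesic_of m M `[0, alpha] gamma].
Proof.
destruct m as [|m]; first by [].
have /smooth_onP[U [oU IU Cg]] := gamma_smooth.
have SU t : 0 <= t <= alpha -> U t by move=> tI; apply: IU; rewrite /= in_itv.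
pose eta := acceleration gamma.
have Cdg k : Ck k U (velocity gamma) by exact: Ck_derive1.
have Ceta k : Ck k U eta by apply: (@Ck_derive1 _ _ k U (velocity gamma)).
pose O := [set t | U t /\ eta t != 0].
have oO : open O by apply: open_neq0 => // t; exact: Ck_differentiable (Ceta 0%N).
have OU : O `<=` U by move=> t [].
have O_neq0 t : O t -> eta t != 0 by case.
have SO t : 0 <= t <= alpha -> O t.
  move=> tI; split; first exact: SU.
  have := gamma_curv t tI; apply: contra_neq => eta0.
  by rewrite /curvature -/(eta t) eta0 enorm0.
(* The acceleration remains nonzero on a slightly longer closed interval, where the connection is
   still defined and smooth. *)
have [r r_gt0 rO] := open_segment_margin (ltW halpha) oO SO.
have CetaO k : Ck k O eta by exact: Ck_subset OU (Ceta k).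
pose A := normal_connection eta.
have CA k : Ck k O A by exact: normal_connection_smooth.
have rr : - r <= alpha + r by lra.
have cA t : - r <= t <= alpha + r -> {for t, continuous A}.
  move=> /rO Ot; apply: differentiable_continuous.
  exact: Ck_differentiable (CA 0%N) Ot.
(* The flow needs a coefficient that is continuous and bounded on the whole line. *)
have [A' [C [cA' A'C A'A A'range]]] := continuous_extension rr cA.
have skA' t : (A' t)^T = - A' t.
  by have [s _ ->] := A'range t; exact: normal_connection_skew.
have [Phi [Phi0 dPhi' PhiO]] := skew_flow cA' A'C skA'.
have dPhi (t : R) : - r <= t <= alpha + r -> is_derive t 1 Phi (Phi t *m A t).
  by move=> tI; rewrite -A'A.
have S0 : (0 : R) <= (0 : R) <= alpha by lra.
have SI t : 0 <= t <= alpha -> - r <= t <= alpha + r by move=> tI; lra.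
have unit_velocity t : 0 <= t <= alpha ->
    velocity gamma t *m (velocity gamma t)^T = 1%:M.
  by move=> tI; apply/mulmx_unit/gamma_unit; rewrite /= in_itv.
have v_neq0 : velocity gamma 0 != 0.
  have := unit_velocity 0 S0; apply: contra_eq_neq => ->.
  rewrite mul0mx eq_sym; apply/eqP => /(congr1 (fun B : 'M[R]_1 => B 0 0)).
  by rewrite !mxE => /eqP; rewrite oner_eq0.
have [P [K [e0P PK D0P]]] := exists_basis_with_first_row dimD0 D0_tangent v_neq0.
pose F := strip_frame Phi P.
have dF (t : R) : - r <= t <= alpha + r -> is_derive t 1 F (F t *m A t).
  move=> tI.
  have := is_derive_mulmx (is_derive_cst P t (1 : R)) (dPhi t tI).
  by rewrite mul0mx add0r mulmxA.
have F0 : F 0 = P by rewrite /F /strip_frame Phi0 mulmx1.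
have Feta0 : F 0 *m (eta 0)^T = 0.
  rewrite F0; apply/matrixP => i j; rewrite ord1 [RHS]mxE.
  have -> : (P *m (eta 0)^T) i 0 = dot (eta 0) (row i P).
    by rewrite mxE; apply: eq_bigr => l _; rewrite !mxE mulrC.
  apply: D0_normal.
  by rewrite D0P /=; exists (delta_mx 0 i); rewrite -rowE.
have Feta t : - r <= t <= alpha + r -> F t *m (eta t)^T = 0.
  exact: (frame_stays_normal CetaO O_neq0 rO dF (SI 0 S0) Feta0).
pose rho t := - (sqnorm eta t)^-1 *: (F t *m (derive1 eta t)^T).
have FA t : - r <= t <= alpha + r -> F t *m A t = rho t *m eta t.
  by move=> tI; apply/mulmx_connection/Feta.
pose J : set R := [set t | - r < t < alpha + r].
have oJ : open J.
  have -> : J = `](- r), (alpha + r)[ by apply/seteqP; split=> t; rewrite /= in_itv.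
  exact: interval_open.
have JI t : J t -> - r <= t <= alpha + r by move=> /andP[/ltW-> /ltW->].
have JO : J `<=` O by move=> t /JI/rO.
have CPhi k : Ck k J Phi.
  apply: Ck_flow oJ (fun j => Ck_subset JO (CA j)) _ k => t /JI; exact: dPhi.
have Crho k : Ck k J rho.
  have Cd : Ck k J (derive1 eta) by apply/Ck_derive1/(Ck_subset JO).
  have Cs : Ck k J (sqnorm eta).
    have Ce := Ck_subset JO (CetaO k).
    exact: (Ck_mxP _ _ oJ).1 (Ck_mulmx oJ Ce (Ck_trmx oJ Ce)) 0 0.
  have s_neq0 t : J t -> sqnorm eta t != 0.
    by move=> /JO; exact: sqnorm_neq0.
  apply: Ck_scalemx => //.
    apply: Ck_eq oJ _ (Ck_scale (-1) oJ (Ck_inv oJ s_neq0 Cs)) => t _.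
    by rewrite scaleN1r.
  apply: Ck_mulmx => //; last exact: Ck_trmx.
  by apply: Ck_mulmx => //; exact: Ck_cst.
have dv (t : R) : 0 <= t <= alpha -> is_derive t 1 (velocity gamma) (eta t).
  by move=> /SU; exact: Ck_is_derive (Cdg 0%N).
have deta (t : R) : 0 <= t <= alpha -> is_derive t 1 eta (derive1 eta t).
  by move=> /SU; exact: Ck_is_derive (Ceta 0%N).
have tr11 (B : 'M[R]_1) : B^T = B by rewrite [B]mx11_scalar tr_scalar_mx.
(* Unit speed is differentiated once here and once more in [v_deta]; both identities hold on the
   interval only. *)
have v_eta t : 0 <= t <= alpha -> velocity gamma t *m (eta t)^T = 0.
  move=> tI.
  have := is_derive_constant_on halpha tI unit_velocity
    (is_derive_mulmx (dv t tI) (is_derive_trmx (dv t tI))).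
  have -> : eta t *m (velocity gamma t)^T = velocity gamma t *m (eta t)^T.
    by rewrite -[LHS]tr11 trmx_mul trmxK.
  by rewrite -mulr2n -scaler_nat => /eqP; rewrite scaler_eq0 pnatr_eq0 => /eqP.
have v_deta t : 0 <= t <= alpha ->
    velocity gamma t *m (derive1 eta t)^T = - (sqnorm eta t)%:M.
  move=> tI.
  have := is_derive_constant_on halpha tI v_eta
    (is_derive_mulmx (dv t tI) (is_derive_trmx (deta t tI))).
  by rewrite [eta t *m _]mx11_scalar -/(sqnorm eta t) addrC => /eqP;
    rewrite addr_eq0 => /eqP.
(* The velocity thus solves the same linear equation as the transported frame. *)
have vA t : 0 <= t <= alpha -> velocity gamma t *m A t = eta t.
  move=> tI; have E := mulmx_connection (v_eta t tI).
  have sq0 : sqnorm eta t != 0 := sqnorm_neq0 O_neq0 (SO t tI).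
  rewrite (v_deta t tI) scalerN scaleNr opprK scale_scalar_mx in E.
  by rewrite mulVf// mul1mx in E.
have axisE t : 0 <= t <= alpha -> strip_axis Phi P t = velocity gamma t.
  move=> tI.
  have H (s : R) : 0 <= s <= alpha ->
      is_derive s 1 (fun s => velocity gamma s *m (Phi s)^T) 0.
    move=> sI; apply: is_derive_flow_invariant (dPhi s (SI s sI)).
      exact: normal_connection_skew.
    by rewrite (vA s sI); exact: dv.
  have := derive0_constant H tI S0; rewrite Phi0 trmx1 mulmx1 -e0P => E.
  rewrite /strip_axis /strip_frame mulmxA -E -mulmxA.
  by rewrite (mulmx1C (PhiO t)) mulmx1.
(* Row 0 of the frame is the velocity, whose inner product with the derivative of eta is minus the
   squared norm of eta. *)
have rho1 t : 0 <= t <= alpha -> rho t 0 0 = 1.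
  move=> tI; have -> : rho t 0 0 = ((delta_mx 0 0 : 'rV[R]_m.+1) *m rho t) 0 0.
    by rewrite -rowE [RHS]mxE.
  rewrite /rho -scalemxAr mulmxA -/(strip_axis Phi P t) axisE// v_deta//.
  rewrite scalerN scaleNr opprK scale_scalar_mx mulVf.
    by rewrite mxE.
  exact: (sqnorm_neq0 O_neq0 (SO t tI)).
(* An open set of times around the interval on which the slope makes sense. *)
pose I := [set t | J t /\ rho t 0 0 != 0].
have oI : open I.
  apply: open_neq0 => // t Jt.
  exact: Ck_differentiable ((Ck_mxP _ _ oJ).1 (Crho 0%N) 0 0) Jt.
have IJ : I `<=` J by move=> t [].
have SIn t : 0 <= t <= alpha -> I t.
  by move=> tI; split; [rewrite /J /=; lra|rewrite rho1// oner_neq0].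
have caxis : continuous (strip_axis Phi P).
  move=> t; apply: cvg_mulmx; first exact: cvg_cst.
  apply: cvg_mulmx; first exact: cvg_cst.
  apply: differentiable_continuous.
  exact: is_derive1_differentiable (dPhi' t).
have [Y [Y0 dY]] := antiderivative caxis.
(* Replaces the curve outside the interval by one whose velocity is the transported axis. *)
pose delta t := gamma 0 + Y t.
have ddelta (t : R) : is_derive t 1 delta (strip_axis Phi P t).
  by have := is_deriveD (is_derive_cst (gamma 0) _ _) (dY t); rewrite add0r.
have gammaE t : 0 <= t <= alpha -> gamma t = delta t.
  move=> tI.
  have H (s : R) : 0 <= s <= alpha -> is_derive s 1 (fun s => gamma s - delta s) 0.
    move=> sI; have := is_deriveB (Ck_is_derive (Cg 0%N) (SU s sI)) (ddelta s).
    by rewrite axisE// subrr.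
  have := derive0_constant H tI S0.
  by rewrite {2}/delta Y0 addr0 subrr => /eqP; rewrite subr_eq0 => /eqP.
have injg : {in [pred t | 0 <= t <= alpha] &, injective gamma}.
  have [[_ [g gK _]] _] := gamma_emb.
  move=> s t; rewrite !inE => sI tI E.
  by rewrite -[s]gK ?E ?gK//= in_itv.
have [|M [M_rank M_gamma M_tangent M_geodesic]] := @exists_rank_one_strip
  R m (m.+1 + n)%N I A Phi P rho eta delta oI
  (fun t _ => PhiO t) (fun t It => dPhi t (JI t (IJ t It)))
  (fun t It => FA t (JI t (IJ t It))) (fun t It => Feta t (JI t (IJ t It)))
  (fun t It => O_neq0 t (JO t (IJ t It))) (fun t It => proj2 It)
  (fun t _ => ddelta t) (fun k => Ck_subset IJ (CPhi k))
  (fun k => Ck_subset IJ (Crho k)) K PK (fun t _ => normal_connection_skew eta t)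
  _ alpha gamma (ltW halpha) SIn gammaE injg.
  by rewrite e0P; exact: unit_velocity.
exists M; split=> //.
(* An affine subspace containing M contains the curve. *)
- move=> q W dimW MW; apply: (gamma_full q W dimW).
  exact: subset_trans MW.
- by rewrite M_tangent D0P -/F F0.
Qed.
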